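(* There exists a positive integer $\kappa$ such that if a graph $G$ satisfies the following conditions: (i) $d(x)>\kappa$ holds for all $x\in V(G)$; (ii) $\bar d(G_x)\le d(x)-\kappa$ holds for all $x\in V(G)$; (iii) $\lambda_{\min}(G)\ge -3$; then $G$ is the slim graph of a $2$-fat $\{\mathfrak{f}_1,\mathfrak{f}_2,\mathfrak{f}_3\}$-line Hoffman graph.
   Context: All graphs are finite, undirected and simple. $d(x)$ is the degree of $x$ in $G$, $G_x$ is the subgraph of $G$ induced on the set of neighbors of $x$, $\bar d(G_x)$ is the average degree of the graph $G_x$, and $\lambda_{\min}(G)$ is the smallest eigenvalue of the adjacency matrix of $G$. A Hoffman graph $\mathfrak{h}$ is a pair $(H,\ell)$ where $H=(V,E)$ is a graph and $\ell:V\to\{\text{fat},\text{slim}\}$ is a labeling such that no two fat vertices are adjacent and every fat vertex has at least one slim neighbor. The slim graph of $\mathfrak{h}$ is the subgraph of $H$ induced on the slim vertices (an ordinary graph). $\mathfrak{h}$ is $t$-fat if every slim vertex has at least $t$ fat neighbors. An induced Hoffman subgraph of $\mathfrak{h}$ is a Hoffman graph $(H_1,\ell_1)$ with $H_1$ an induced subgraph of $H$ and $\ell_1$ the restriction of $\ell$. For a set $W$ of slim vertices, the induced Hoffman subgraph generated by $W$ is the one induced on $W$ together with all fat vertices having a neighbor in $W$. Isomorphisms of Hoffman graphs are graph isomorphisms preserving labels. The special matrix $S(\mathfrak{h})$ is indexed by slim vertices: $S(\mathfrak{h})=A_{\rm slim}-CC^T$, where $A_{\rm slim}$ is the adjacency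 matrix of the slim graph and $C$ is the slim-by-fat $0/1$ adjacency block. A family $\{\mathfrak{h}^i\}_{i=1}^r$ is a decomposition of $\mathfrak{h}$, written $\mathfrak{h}=\uplus_{i=1}^r\mathfrak{h}^i$, if there is a partition of the slim vertex set of $\mathfrak{h}$ into $r$ parts such that $\mathfrak{h}^i$ is the induced Hoffman subgraph generated by the $i$-th part and $S(\mathfrak{h})$ is block diagonal with blocks $S(\mathfrak{h}^1),\dots,S(\mathfrak{h}^r)$ with respect to this partition. For a family $\mathfrak{H}$ of pairwise non-isomorphic Hoffman graphs, a Hoffman graph $\mathfrak{h}$ is an $\mathfrak{H}$-line Hoffman graph if there is a Hoffman graph $\mathfrak{h}'$ such that $\mathfrak{h}'$ has $\mathfrak{h}$ as an induced Hoffman subgraph, $\mathfrak{h}'$ has the same slim graph as $\mathfrak{h}$, and $\mathfrak{h}'=\uplus_{i=1}^r\mathfrak{h}'_i$ where each $\mathfrak{h}'_i$ is isomorphic to an induced Hoffman subgraph of some member of $\mathfrak{H}$. The Hoffman graphs $\mathfrak{f}_1,\mathfrak{f}_2,\mathfrak{f}_3$: - $\mathfrak{f}_1$ has one slim vertex adjacent to three fat vertices. - $\mathfrak{f}_2$ has four slim vertices $x_1,x_2,y_1,y_2$ and four fat vertices $F_{ij}$ ($i,j\in\{1,2\}$); the slim-slim edges are exactly $x_1x_2$ and $y_1y_2$; $x_i$ is adjacent to exactly the fat vertices $F_{i1},F_{i2}$ and $y_j$ to exactly $F_{1j},F_{2j}$. - $\mathfrak{f}_3$ has two adjacent slim vertices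 and two fat vertices, each slim vertex being adjacent to both fat vertices. *)

(* Defs.v *)
From HB Require Import structures.
From mathcomp Require Import all_boot all_order all_algebra.
From mathcomp Require Import classical_sets reals.

Set Implicit Arguments.
Unset Strict Implicit.
Unset Printing Implicit Defensive.

Import Order.TTheory GRing.Theory Num.Theory.
Local Open Scope ring_scope.

Record sgraph := SGraph {
  vertex :> finType;
  adj : rel vertex;
  adj_sym : symmetric adj;
  adj_irrefl : irreflexive adj }.

Definition neigh (G : sgraph) (x : G) : {set G} := [set y | adj x y].

Definition deg (G : sgraph) (x : G) : nat := #|neigh x|.

Definition graph_iso (G H : sgraph) : Prop :=
  exists2 f : G -> H, bijective f & forall x y, adj (f x) (f y) = adj x y.

Section InducedGraph.
Variables (G : sgraph) (U : {set G}).

Definition ind_adj : rel {x : G | x \in U} := fun x y => adj (val x) (val y).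

Lemma ind_adj_sym : symmetric ind_adj.
Proof. by move=> x y; apply: adj_sym. Qed.

Lemma ind_adj_irrefl : irreflexive ind_adj.
Proof. by move=> x; apply: adj_irrefl. Qed.

Definition induced_graph : sgraph := SGraph ind_adj_sym ind_adj_irrefl.

End InducedGraph.

Definition local_graph (G : sgraph) (x : G) : sgraph := induced_graph (neigh x).

(* Equals 0 on the graph without vertices, since 0^-1 = 0. *)
Definition avg_deg (R : realType) (G : sgraph) : R :=
  (\sum_(x : G) deg x)%:R / #|{: G}|%:R.

Definition adj_mx (R : pzRingType) (G : sgraph) : 'M[R]_#|{: G}| :=
  \matrix_(i, j) (adj (enum_val i) (enum_val j))%:R.

(* The set of eigenvalues is finite, and nonempty when G has a vertex, so this
   infimum is then a minimum. It is 0 on the graph without vertices. *)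
Definition lambda_min (R : realType) (G : sgraph) : R :=
  inf [set a : R | eigenvalue (adj_mx R G) a]%classic.

Record hoffman := Hoffman {
  hgraph :> sgraph;
  fat : pred hgraph;
  fat_indep : forall x y, fat x -> fat y -> ~~ adj x y;
  fat_has_slim : forall x, fat x -> exists2 y, ~~ fat y & adj x y }.

Definition slim_set (h : hoffman) : {set h} := [set x | ~~ fat x].
Definition fat_set (h : hoffman) : {set h} := [set x | fat x].

Definition slim_graph (h : hoffman) : sgraph := induced_graph (slim_set h).

Definition t_fat (t : nat) (h : hoffman) : Prop :=
  forall x : h, ~~ fat x -> (t <= #|neigh x :&: fat_set h|)%N.

Definition hoffman_iso (h k : hoffman) : Prop :=
  exists f : h -> k, [/\ bijective f,
    forall x y, adj (f x) (f y) = adj x y & forall x, fat (f x) = fat x].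

(* The vertex sets U such that the induced labeled subgraph on U is again a
   Hoffman graph. *)
Definition hoffman_set (h : hoffman) (U : {set h}) : Prop :=
  forall x, x \in U -> fat x -> exists2 y, y \in U & ~~ fat y && adj x y.

Section InducedHoffman.
Variables (h : hoffman) (U : {set h}) (hU : hoffman_set U).

Definition ind_fat : pred (induced_graph U) := fun x => fat (val x).

Lemma ind_fat_indep (x y : induced_graph U) :
  ind_fat x -> ind_fat y -> ~~ adj x y.
Proof. exact: fat_indep. Qed.

Lemma ind_fat_has_slim (x : induced_graph U) :
  ind_fat x -> exists2 y, ~~ ind_fat y & adj x y.
Proof.
move=> fx; have [y yU /andP[sy axy]] := hU (valP x) fx.
by exists (exist _ y yU).
Qed.

Definition induced_hoffman : hoffman := Hoffman ind_fat_indep ind_fat_has_slim.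

Lemma ind_slim_proof (x : slim_graph induced_hoffman) :
  val (val x) \in slim_set h.
Proof. by have := valP x; rewrite !inE. Qed.

Definition ind_slim_inj (x : slim_graph induced_hoffman) : slim_graph h :=
  exist _ (val (val x)) (ind_slim_proof x).

End InducedHoffman.

Section Generated.
Variables (h : hoffman) (W : {set slim_graph h}).

Definition generated_set : {set h} :=
  [set val x | x in W] :|:
  [set f in fat_set h | [exists x in W, adj f (val x)]].

Lemma generated_setP : hoffman_set generated_set.
Proof.
move=> f + ff; rewrite inE => /orP[/imsetP[x _ fx]|].
  by have := valP x; rewrite inE -fx ff.
rewrite !inE => /andP[_ /existsP[x /andP[xW afx]]].
exists (val x); first by rewrite inE imset_f.
by have := valP x; rewrite inE => ->.
Qed.

Definition generated : hoffman := induced_hoffman generated_setP.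

End Generated.

Definition slim_fat_mx (h : hoffman) :
    'M[int]_(#|{: slim_graph h}|, #|{: induced_graph (fat_set h)}|) :=
  \matrix_(i, j) (adj (val (enum_val i)) (val (enum_val j)))%:R.

Definition special_mx (h : hoffman) : 'M[int]_#|{: slim_graph h}| :=
  adj_mx int (slim_graph h) - slim_fat_mx h *m (slim_fat_mx h)^T.

Definition special (h : hoffman) (x y : slim_graph h) : int :=
  special_mx h (enum_rank x) (enum_rank y).

(* The members of the decomposition are the Hoffman graphs [generated B] for B
   in P. The last two conditions say that S(h) is block diagonal with respect
   to P with diagonal blocks S(generated B). *)
Definition decomposition (h : hoffman) (P : {set {set slim_graph h}}) : Prop :=
  [/\ finset.partition P [set: slim_graph h],
      forall B, B \in P -> forall x y : slim_graph (generated B),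
        special (ind_slim_inj x) (ind_slim_inj y) = special x y &
      forall B D, B \in P -> D \in P -> B != D ->
        forall x y, x \in B -> y \in D -> special x y = 0].

Definition iso_to_induced (k h : hoffman) : Prop :=
  exists (U : {set h}) (hU : hoffman_set U), hoffman_iso k (induced_hoffman hU).

(* Up to isomorphism, h is the induced Hoffman subgraph of h' on U; as such it
   has the same slim graph as h' when U contains all slim vertices of h'. *)
Definition line_hoffman (I : Type) (H : I -> hoffman) (h : hoffman) : Prop :=
  exists h' : hoffman,
    (exists (U : {set h'}) (hU : hoffman_set U),
        hoffman_iso h (induced_hoffman hU) /\ slim_set h' \subset U) /\
    (exists2 P : {set {set slim_graph h'}}, decomposition P &
        forall B, B \in P -> exists i, iso_to_induced (generated B) (H i)).

(* The Hoffman graph with slim vertices [inl _], fat vertices [inr _], slim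
   graph e and slim-fat adjacency c. *)
Section SlimFat.
Variables (S F : finType) (e : rel S) (c : S -> F -> bool).
Hypotheses (e_sym : symmetric e) (e_irrefl : irreflexive e).
Hypothesis c_surj : forall f, exists s, c s f.

Definition sf_adj : rel (S + F) := fun u v =>
  match u, v with
  | inl x, inl y => e x y
  | inl x, inr f => c x f
  | inr f, inl x => c x f
  | inr _, inr _ => false
  end.

Lemma sf_adj_sym : symmetric sf_adj.
Proof. by move=> [x|f] [y|g] //=. Qed.

Lemma sf_adj_irrefl : irreflexive sf_adj.
Proof. by move=> [x|f] //=. Qed.

Definition sf_graph : sgraph := SGraph sf_adj_sym sf_adj_irrefl.

Definition sf_fat : pred sf_graph := fun u => if u is inr _ then true else false.

Lemma sf_fat_indep (u v : sf_graph) : sf_fat u -> sf_fat v -> ~~ adj u v.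
Proof. by case: u => [x|f]; case: v => [y|g]. Qed.

Lemma sf_fat_has_slim (u : sf_graph) :
  sf_fat u -> exists2 v, ~~ sf_fat v & adj u v.
Proof. by case: u => [x|f] //= _; have [s csf] := c_surj f; exists (inl s). Qed.

Definition sf_hoffman : hoffman := Hoffman sf_fat_indep sf_fat_has_slim.

End SlimFat.

Definition f1_slim : rel unit := fun _ _ => false.
Definition f1_inc (_ : unit) (_ : 'I_3) : bool := true.

Lemma f1_slim_sym : symmetric f1_slim. Proof. by []. Qed.
Lemma f1_slim_irrefl : irreflexive f1_slim. Proof. by []. Qed.
Lemma f1_inc_surj f : exists s, f1_inc s f. Proof. by exists tt. Qed.

Definition f1 : hoffman := sf_hoffman f1_slim_sym f1_slim_irrefl f1_inc_surj.

(* With {false, true} for {1, 2}: x_i is (false, i), y_j is (true, j), and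
   F_ij is (i, j). *)
Definition f2_slim : rel (bool * bool) :=
  fun u v => (u.1 == v.1) && (u.2 != v.2).
Definition f2_inc (u f : bool * bool) : bool :=
  if u.1 then u.2 == f.2 else u.2 == f.1.

Lemma f2_slim_sym : symmetric f2_slim. Proof. by case=> [[] []] [[] []]. Qed.
Lemma f2_slim_irrefl : irreflexive f2_slim. Proof. by case=> [[] []]. Qed.
Lemma f2_inc_surj f : exists s, f2_inc s f.
Proof. by exists (false, f.1); rewrite /f2_inc /=. Qed.

Definition f2 : hoffman := sf_hoffman f2_slim_sym f2_slim_irrefl f2_inc_surj.

Definition f3_slim : rel bool := fun x y => x != y.
Definition f3_inc (_ _ : bool) : bool := true.

Lemma f3_slim_sym : symmetric f3_slim. Proof. by case=> [] []. Qed.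
Lemma f3_slim_irrefl : irreflexive f3_slim. Proof. by case. Qed.
Lemma f3_inc_surj f : exists s, f3_inc s f. Proof. by exists true. Qed.

Definition f3 : hoffman := sf_hoffman f3_slim_sym f3_slim_irrefl f3_inc_surj.

Definition f_family (i : 'I_3) : hoffman :=
  match val i with 0%N => f1 | 1%N => f2 | _ => f3 end.

Lemma sf_card_fat (S F : finType) (e : rel S) (c : S -> F -> bool)
    (es : symmetric e) (ei : irreflexive e) (cs : forall f, exists s, c s f) :
  #|fat_set (sf_hoffman es ei cs)| = #|F|.
Proof.
rewrite -(@card_imset _ _ (@inr S F)) => [|? ? [] //].
apply: eq_card => -[s|f]; rewrite /= inE /=.
  by apply/esym/negbTE/imsetP => -[].
by apply/esym/imsetP; exists f.
Qed.

Lemma hoffman_iso_card_fat (h k : hoffman) :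
  hoffman_iso h k -> #|fat_set h| = #|fat_set k|.
Proof.
move=> [f [[g fK gK] _ ff]].
rewrite -(card_imset (fat_set h) (can_inj fK)); apply: eq_card => y.
rewrite -{1}[y]gK (mem_imset _ _ (can_inj fK)) !inE.
by rewrite -ff gK.
Qed.

Lemma f_family_pairwise_noniso (i j : 'I_3) :
  hoffman_iso (f_family i) (f_family j) -> i = j.
Proof.
move=> /hoffman_iso_card_fat.
case: i j => [[|[|[|//]]] ?] [[|[|[|//]]] ?] E; apply/val_inj => //=; move: E;
  by rewrite /f_family /= !sf_card_fat
     ?card_ord ?card_prod ?card_bool.
Qed.

(* Main.v *)
(* The form of A + 3I is positive semidefinite, and for it the mean of a large
   clique is nearly a unit vector. By Cauchy-Schwarz its product with a
   vertex, or with the mean of another large clique, is nearly 0 or 1. Large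
   cliques with product near 1 form equivalence classes; these are the fat
   vertices, adjacent to the slim vertices having product near 1 with them.
   Distinct fat vertices are nearly orthonormal, so projecting them away shows
   that S + 3I is positive semidefinite on any three slim vertices. It follows
   that no slim vertex has more than three fat neighbors, while Ramsey's theorem
   and the condition on the average degree give at least two. The diagonal of
   S + 3I is then 0 or 1, which forces S + 3I to be a direct sum of zero blocks
   and blocks v v^T with v a vector of signs. A zero block is a copy of f1. A
   block with both signs embeds in f2 or f3, by counting common fat neighbors.
   An all-ones block splits into copies of f1 once a new fat vertex is attached
   to all its members. *)
Require Import Defs.
From mathcomp Require Import all_boot all_order all_algebra.
From mathcomp Require Import classical_sets reals.
(* fintype and finset again, since classical_sets shadows some of their lemmas *)
From mathcomp Require Import fintype finset complex ring lra zify.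
Set Implicit Arguments.
Unset Strict Implicit.
Unset Printing Implicit Defensive.
Import Order.TTheory GRing.Theory Num.Theory.
Local Open Scope ring_scope.

(** * Smallest eigenvalue and quadratic form *)

(** By the spectral theorem over [R[i]], in the coordinates [w] of [v] both sides are weighted sums
    of the [|w_j|^2], with weights [c] and [d_j]. The [d_j] are real, hence eigenvalues of [A]
    itself. *)
Lemma ler_quad_eigenvalue (R : rcfType) n (A : 'M[R]_n) (c : R) :
    A^T = A -> (forall a, eigenvalue A a -> c <= a) ->
  forall v : 'rV_n, c * (v *m v^T) 0 0 <= (v *m A *m v^T) 0 0.
Proof.
move=> symA minA v; pose f := real_complex R; pose B := map_mx f A.
have hermB : B \is hermsymmx.
  apply: realsym_hermsym.
    by apply/is_hermitianmxP; rewrite expr0 scale1r map_mx_id // map_trmx symA.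
  by apply/mxOverP => i j; rewrite mxE; apply/complex_realP; exists (A i j).
have /orthomx_spectralP BE := hermitian_normalmx hermB.
have realD := hermitian_spectral_diag_real hermB.
have unitP := spectral_unitarymx B.
move: BE realD unitP; set P := spectralmx B; set d := spectral_diag B.
move=> BE /mxOverP realD unitP.
have eigD j : c <= complex.Re (d 0 j).
  apply: minA; rewrite -(eigenvalue_map f) -/B /= [_%:C%C]RRe_real //.
  apply/eigenvalueP; exists (delta_mx 0 j *m P).
    rewrite {1}BE !mulmxA mulmxK ?unitarymx_unit // scalemxAl; congr (_ *m P).
    apply/rowP => k; rewrite mul_mx_diag !mxE eqxx /=.
    by case: eqP => [->|_]; rewrite ?mul0r ?mulr0 // mul1r mulr1.
  apply/eqP => dP0; have: delta_mx 0 j *m P *m invmx P = 0 :> 'rV_n.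
    by rewrite dP0 mul0mx.
  rewrite mulmxK ?unitarymx_unit // => /rowP/(_ j); rewrite !mxE !eqxx.
  by move/eqP; rewrite oner_eq0.
pose w := map_mx f v *m invmx P.
have wE : map_mx Num.conj w^T = P *m map_mx f v^T.
  rewrite trmx_mul map_mxM invmx_unitary // trmxCK -map_trmx; congr (_ *m _).
  apply/colP => i; rewrite !mxE /=; apply/CrealP/complex_realP.
  by exists (v 0 i).
have vv : f ((v *m v^T) 0 0) = \sum_j `|w 0 j| ^+ 2.
  transitivity ((w *m map_mx Num.conj w^T) 0 0).
    rewrite wE mulmxA mulmxKV ?unitarymx_unit // -map_mxM.
    by rewrite [in RHS]mxE.
  by rewrite mxE; apply: eq_bigr => j _; rewrite !mxE normCK.
have vAv : f ((v *m A *m v^T) 0 0) = \sum_j d 0 j * `|w 0 j| ^+ 2.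
  transitivity ((w *m diag_mx d *m map_mx Num.conj w^T) 0 0).
    have -> : w *m diag_mx d *m map_mx Num.conj w^T =
        map_mx f v *m (invmx P *m diag_mx d *m P) *m map_mx f v^T.
      by rewrite wE /w !mulmxA.
    by rewrite -BE -!map_mxM [in RHS]mxE.
  rewrite mxE; apply: eq_bigr => j _.
  by rewrite mul_mx_diag !mxE normCK mulrAC mulrC.
rewrite -lecR.
have -> (a b : R) : (a * b)%:C%C = f a * f b by exact: (rmorphM f).
rewrite vv -[X in _ <= X]/(f _) vAv mulr_sumr; apply: ler_sum => j _.
apply: ler_wpM2r; first by rewrite exprn_ge0.
by rewrite -[d 0 j]RRe_real // lecR.
Qed.

(** Some lower bound is needed for the infimum in [lambda_min] to lie below every eigenvalue. This
    one comes from the coordinate of largest absolute value in an eigenvector. *)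
Lemma eigenvalue_adj_ge (R : realFieldType) (G : sgraph) (a : R) :
  eigenvalue (adj_mx R G) a -> - #|{: G}|%:R <= a.
Proof.
case/eigenvalueP => v vA v_neq0.
have /existsP[i0 vi0] : [exists i, v 0 i != 0].
  apply: contraNT v_neq0 => /existsPn v0; apply/eqP/rowP => i.
  by rewrite mxE; apply/eqP; rewrite -[_ == _]negbK v0.
pose i := [arg max_(i > i0) `|v 0 i|]%O.
have maxv j : `|v 0 j| <= `|v 0 i|.
  by rewrite /i; case: Order.TotalTheory.arg_maxP => // k _; apply.
have vi : 0 < `|v 0 i| by rewrite (lt_le_trans _ (maxv i0)) ?normr_gt0.
suff: `|a| <= #|{: G}|%:R by rewrite ler_norml => /andP[].
have /rowP/(_ i) := vA; rewrite !mxE => vAi.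
rewrite -(ler_pM2r vi) -normrM -vAi; apply: le_trans (ler_norm_sum _ _ _) _.
have -> : #|{: G}|%:R * `|v 0 i| = \sum_(j < #|{: G}|) `|v 0 i|.
  by rewrite sumr_const card_ord mulr_natl.
apply: ler_sum => j _; rewrite normrM mxE.
by case: adj; rewrite ?normr1 ?normr0 ?mulr1 ?mulr0 ?maxv // normr_ge0.
Qed.

Lemma adj_quad_ge (R : realType) (G : sgraph) (c : R) :
    c <= lambda_min R G ->
  forall u : G -> R, c * (\sum_x u x ^+ 2) <=
    \sum_x \sum_y u x * u y * (adj x y)%:R.
Proof.
move=> minG u; pose v : 'rV[R]_#|{: G}| := \row_i u (enum_val i).
have symA : (adj_mx R G)^T = adj_mx R G.
  by apply/matrixP => i j; rewrite !mxE adj_sym.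
have := @ler_quad_eigenvalue R _ _ c symA _ v.
have -> : (v *m v^T) 0 0 = \sum_x u x ^+ 2.
  rewrite mxE (reindex _ (onW_bij _ (enum_val_bij G))) /=.
  by apply: eq_bigr => i _; rewrite !mxE expr2.
have -> : (v *m adj_mx R G *m v^T) 0 0 =
    \sum_x \sum_y u x * u y * (adj x y)%:R.
  rewrite mxE exchange_big (reindex _ (onW_bij _ (enum_val_bij G))) /=.
  apply: eq_bigr => i _; rewrite mxE mulr_suml.
  rewrite (reindex _ (onW_bij _ (enum_val_bij G))) /=.
  by apply: eq_bigr => j _; rewrite !mxE mulrAC.
apply=> a eig_a; apply: le_trans minG _; apply: ge_inf; last exact: eig_a.
by exists (- #|{: G}|%:R) => b /eigenvalue_adj_ge.
Qed.

(** * Cliques and the form of A + 3I *)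

Section Ramsey.
Variables (T : finType) (e : rel T).
Hypothesis e_sym : symmetric e.

(** Fix [v] in [S]. Its neighbors and its non-neighbors in [S] cannot both number less than half of
    the bound, since together with [v] they exhaust [S]. A clique among the former or an independent
    set among the latter extends by [v]. *)
Lemma ramsey (a b : nat) (S : {set T}) : (2 ^ (a + b) <= #|S|)%N ->
  (exists K : {set T}, [/\ K \subset S, #|K| = a &
    {in K &, forall x y, x != y -> e x y}]) \/
  (exists K : {set T}, [/\ K \subset S, #|K| = b &
    {in K &, forall x y, x != y -> ~~ e x y}]).
Proof.
have triv (P : T -> T -> Prop) (S' : {set T}) : exists K : {set T},
    [/\ K \subset S', #|K| = 0%N & {in K &, forall x y, x != y -> P x y}].
  by exists set0; split; rewrite ?sub0set ?cards0 // => x y; rewrite inE.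
elim: a b S => [|a IHa] b S; first by left; apply: triv.
elim: b S => [|b IHb] S hS; first by right; apply: triv.
have /card_gt0P[v vS] : (0 < #|S|)%N by apply: leq_trans hS; rewrite expn_gt0.
pose S1 := [set x in S :\ v | e v x]; pose S2 := [set x in S :\ v | ~~ e v x].
have cS : #|S| = (#|S1| + #|S2|).+1.
  rewrite (cardsD1 v S) vS add1n; congr _.+1.
  rewrite -(cardsID [set x | e v x] (S :\ v)); congr (_ + _)%N;
    by apply: eq_card => x; rewrite !inE // andbC.
have add_v (S' K : {set T}) : S' \subset S :\ v -> K \subset S' ->
    v |: K \subset S /\ #|v |: K| = #|K|.+1.
  move=> sS' sK; have vK : v \notin K.
    by apply/negP => /(subsetP sK)/(subsetP sS'); rewrite !inE eqxx.
  rewrite cardsU1 vK subUset sub1set vS; split=> //=.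
  by apply: subset_trans sK (subset_trans sS' _); apply: subD1set.
have sS1 : S1 \subset S :\ v by apply/subsetP => x; rewrite !inE => /andP[].
have sS2 : S2 \subset S :\ v by apply/subsetP => x; rewrite !inE => /andP[].
have [h1|h1] := leqP (2 ^ (a + b.+1)) #|S1|.
  have [[K [sK cK eK]]|[K [sK cK eK]]] := IHa b.+1 S1 h1; last first.
    right; exists K; split=> //.
    exact: subset_trans sK (subset_trans sS1 (subD1set _ _)).
  left; have [sK' cK'] := add_v _ _ sS1 sK; exists (v |: K); split; rewrite ?cK' ?cK //.
  have ev x : x \in K -> e v x by move/(subsetP sK); rewrite inE => /andP[].
  move=> x y /setU1P[->|xK] /setU1P[->|yK] //; rewrite ?eqxx //; first by rewrite ev.
    by rewrite e_sym ev.
  exact: eK.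
have h2 : (2 ^ (a.+1 + b) <= #|S2|)%N.
  move: hS h1; rewrite cS !addSn !addnS !expnS; lia.
have [[K [sK cK eK]]|[K [sK cK eK]]] := IHb S2 h2.
  by left; exists K; split=> //; apply: subset_trans sK (subset_trans sS2 (subD1set _ _)).
right; have [sK' cK'] := add_v _ _ sS2 sK; exists (v |: K); split; rewrite ?cK' ?cK //.
have ev x : x \in K -> ~~ e v x by move/(subsetP sK); rewrite inE => /andP[].
move=> x y /setU1P[->|xK] /setU1P[->|yK] //; rewrite ?eqxx //; first by rewrite ev.
  by rewrite e_sym ev.
exact: eK.
Qed.

End Ramsey.

Definition clique (G : sgraph) (C : {set G}) : bool :=
  [forall x in C, forall y in C, (x != y) ==> adj x y].

Lemma cliqueP (G : sgraph) (C : {set G}) :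
  reflect {in C &, forall x y, x != y -> adj x y} (clique C).
Proof.
apply: (iffP 'forall_in_forall_inP) => h x => [y xC yC|xC y yC].
  exact/implyP/h.
by apply/implyP/h.
Qed.

Section Form.
Variables (R : realFieldType) (G : sgraph).
Implicit Types (u v w : {ffun G -> R^o}) (x y : G) (C : {set G}).

(** The bilinear form with matrix A + 3I; [R^o] gives these functions their vector space structure
    over [R]. *)
Definition form u v : R :=
  \sum_x \sum_y u x * v y * ((adj x y)%:R + 3 * (x == y)%:R).

Definition ev x : {ffun G -> R^o} := [ffun z => (z == x)%:R].

Definition mean C : {ffun G -> R^o} := #|C|%:R^-1 *: \sum_(x in C) ev x.

Lemma formC u v : form u v = form v u.
Proof.
rewrite /form exchange_big; apply: eq_bigr => x _; apply: eq_bigr => y _.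
by rewrite adj_sym eq_sym [u y * _]mulrC.
Qed.

Lemma formDl u v w : form (u + v) w = form u w + form v w.
Proof.
rewrite /form -big_split; apply: eq_bigr => x _; rewrite -big_split.
by apply: eq_bigr => y _; rewrite ffunE !mulrDl.
Qed.

Lemma formZl k u w : form (k *: u) w = k * form u w.
Proof.
rewrite /form mulr_sumr; apply: eq_bigr => x _; rewrite mulr_sumr.
by apply: eq_bigr => y _; rewrite ffunE !mulrA.
Qed.

Lemma formDr u v w : form w (u + v) = form w u + form w v.
Proof. by rewrite ![form w _]formC formDl. Qed.

Lemma formZr k u w : form w (k *: u) = k * form w u.
Proof. by rewrite ![form w _]formC formZl. Qed.

Lemma formBr u v w : form w (u - v) = form w u - form w v.
Proof. by rewrite -scaleN1r formDr formZr mulN1r. Qed.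

Lemma form_sumr (I : Type) (r : seq I) (P : pred I) (F : I -> {ffun G -> R^o}) u :
  form u (\sum_(i <- r | P i) F i) = \sum_(i <- r | P i) form u (F i).
Proof.
apply: (big_morph (form u)) => [v w|]; first exact: formDr.
by rewrite -(scale0r (0 : {ffun G -> R^o})) formZr mul0r.
Qed.

Lemma form_suml (I : Type) (r : seq I) (P : pred I) (F : I -> {ffun G -> R^o}) u :
  form (\sum_(i <- r | P i) F i) u = \sum_(i <- r | P i) form (F i) u.
Proof. by rewrite formC form_sumr; under eq_bigr do rewrite formC. Qed.

Lemma form_ev x y : form (ev x) (ev y) = (adj x y)%:R + 3 * (x == y)%:R.
Proof.
rewrite /form (bigD1 x) //= [X in _ + X]big1 => [|z /negbTE zx].
  rewrite addr0 (bigD1 y) //= [X in _ + X]big1 => [|z /negbTE zy].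
    by rewrite !ffunE !eqxx !mul1r addr0.
  by rewrite !ffunE zy mulr0 mul0r.
by rewrite big1 // => t _; rewrite ffunE zx !mul0r.
Qed.

Lemma form_evxx x : form (ev x) (ev x) = 3.
Proof. by rewrite form_ev adj_irrefl eqxx add0r mulr1. Qed.

Lemma form_mean u C : form u (mean C) = #|C|%:R^-1 * \sum_(x in C) form u (ev x).
Proof. by rewrite formZr form_sumr. Qed.

Lemma form_subZ k u v : form (u - k *: v) (u - k *: v) =
  form u u - 2 * k * form u v + k ^+ 2 * form v v.
Proof.
rewrite -scaleNr !(formDl, formDr, formZl, formZr) (formC v u).
by ring.
Qed.

Lemma form_ev_mean x C : x \notin C -> {in C, forall y, adj x y} ->
  (0 < #|C|)%N -> form (ev x) (mean C) = 1.
Proof.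
move=> xC aC C0; rewrite form_mean (eq_bigr (fun=> 1)) => [|y yC].
  by rewrite sumr_const mulVf // pnatr_eq0 -lt0n.
rewrite form_ev aC // (_ : x == y = false) ?mulr0 ?addr0 //.
by apply/eqP => xy; rewrite xy yC in xC.
Qed.

Lemma form_ev_meanC x C : clique C -> x \in C ->
  form (ev x) (mean C) = 1 + 2 / #|C|%:R.
Proof.
move=> /cliqueP clC xC; have C0 : (0 < #|C|)%N by apply/card_gt0P; exists x.
rewrite form_mean (eq_bigr (fun y => 1 + 2 * (x == y)%:R)) => [|y yC].
  rewrite big_split sumr_const -mulr_sumr mulrDr mulVf ?pnatr_eq0 -?lt0n //.
  rewrite (bigD1 x) //= eqxx big1 => [|y /andP[_ /negbTE]]; last first.
    by rewrite eq_sym => ->.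
  by rewrite addr0 mulr1 mulrC.
rewrite form_ev; have [->|xy] := eqVneq x y; last by rewrite clC // !mulr0 !addr0.
by rewrite adj_irrefl /=; lra.
Qed.

Lemma form_ev_mean_ge0 x C : 0 <= form (ev x) (mean C).
Proof.
rewrite form_mean mulr_ge0 ?invr_ge0 ?ler0n // sumr_ge0 // => y _.
by rewrite form_ev addr_ge0 ?mulr_ge0 ?ler0n.
Qed.

Lemma form_ev_mean_le x C : (0 < #|C|)%N ->
  form (ev x) (mean C) <= 1 + 2 / #|C|%:R.
Proof.
move=> C0; have C0R : 0 < #|C|%:R :> R by rewrite ltr0n.
rewrite form_mean mulrC ler_pdivrMr // mulrDl mul1r mulfVK ?gt_eqF //.
apply: le_trans (_ : _ <= \sum_(y in C) (1 + 2 * (x == y)%:R)) _.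
  apply: ler_sum => y _; rewrite form_ev; have [<-|xy] := eqVneq x y.
    by rewrite adj_irrefl /=; lra.
  by rewrite !mulr0 !addr0 lern1 leq_b1.
rewrite big_split sumr_const lerD2l -mulr_sumr ler_piMr // -natr_sum lern1.
rewrite big_mkcond (bigD1 x) //= big1 => [|y /negbTE]; last first.
  by rewrite eq_sym => ->; case: ifP.
by case: ifP; rewrite ?eqxx.
Qed.

Lemma form_meanE u C : form (mean C) u = #|C|%:R^-1 * \sum_(x in C) form (ev x) u.
Proof. by rewrite formC form_mean; under eq_bigr do rewrite formC. Qed.

Lemma mean_le u C (k : R) : (0 < #|C|)%N ->
  {in C, forall x, form u (ev x) <= k} -> form u (mean C) <= k.
Proof.
move=> C0 le_k; rewrite form_mean mulrC ler_pdivrMr ?ltr0n //.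
by rewrite mulr_natr -sumr_const; apply: ler_sum.
Qed.

Lemma mean_ge u C (k : R) : (0 < #|C|)%N ->
  {in C, forall x, k <= form u (ev x)} -> k <= form u (mean C).
Proof.
move=> C0 ge_k; rewrite form_mean mulrC ler_pdivlMr ?ltr0n //.
by rewrite mulr_natr -sumr_const; apply: ler_sum.
Qed.

Lemma form_meanCC C : clique C -> (0 < #|C|)%N ->
  form (mean C) (mean C) = 1 + 2 / #|C|%:R.
Proof.
move=> clC C0; rewrite form_meanE (eq_bigr _ (fun x => @form_ev_meanC x C clC)).
by rewrite sumr_const -[X in _ * X]mulr_natl mulKf // pnatr_eq0 -lt0n.
Qed.

Lemma form_mean_disj C D : clique (C :|: D) -> [disjoint C & D] ->
  (0 < #|C|)%N -> (0 < #|D|)%N -> form (mean C) (mean D) = 1.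
Proof.
move=> /cliqueP clCD dCD C0 D0; rewrite form_meanE (eq_bigr (fun=> 1)) => [|x xC].
  by rewrite sumr_const mulVf // pnatr_eq0 -lt0n.
have xD : x \notin D by rewrite (disjointFr dCD).
apply: form_ev_mean => // y yD; apply: clCD; rewrite ?inE ?xC ?yD ?orbT //.
by apply/eqP => xy; rewrite xy yD in xD.
Qed.

End Form.

(** * Products with means of large cliques *)

Section PositiveForm.
Variables (R : realFieldType) (G : sgraph).
Hypothesis psd : forall u : {ffun G -> R^o}, 0 <= form u u.
Implicit Types (u v w : {ffun G -> R^o}) (x y : G) (C D : {set G}).

(* With c_i the mean over C_i, the vector u - 9 (c_1 - c_2) would have negative
   norm, since |c_1 - c_2|^2 = 2/|C_1| + 2/|C_2|. *)
Lemma clique_split u C1 C2 : form u u <= 3 -> clique (C1 :|: C2) ->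
    [disjoint C1 & C2] -> {in C1, forall y, 2 / 3 <= form u (ev R y)} ->
    {in C2, forall y, form u (ev R y) <= 1 / 3} ->
  (#|C1| <= 108)%N \/ (#|C2| <= 108)%N.
Proof.
move=> u3 clC dC big1 small2.
have [|c1] := leqP #|C1| 108; first by left.
have [|c2] := leqP #|C2| 108; first by right.
have C1p : (0 < #|C1|)%N by lia.
have C2p : (0 < #|C2|)%N by lia.
have cl1 : clique C1.
  by apply/cliqueP => x y xC yC; apply: (cliqueP _ clC); rewrite inE ?xC ?yC.
have cl2 : clique C2.
  by apply/cliqueP => x y xC yC; apply: (cliqueP _ clC); rewrite inE ?xC ?yC orbT.
have inv_le (n : nat) : (108 < n)%N -> n%:R^-1 <= 1 / 109 :> R.
  move=> n108; rewrite mul1r lef_pV2 ?posrE ?ltr0n //; last by lia.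
  by rewrite ler_nat.
(* The value is at most 3 - 18 (2/3 - 1/3) + 81 * 4/109 < 0; with 108 in place of 109 this bound
   would be exactly 0. *)
have := psd (u - 9 *: (mean R C1 - mean R C2)).
have i1 := inv_le _ c1; have i2 := inv_le _ c2.
rewrite form_subZ formBr.
rewrite -[X in mean R C1 - X]scale1r form_subZ !form_meanCC // form_mean_disj //.
have m1 := mean_ge C1p big1; have m2 := mean_le C2p small2.
by lra.
Qed.

Section LargeCliques.
Variable N : nat.
Hypothesis largeN : 1000 * 1000 <= N%:R :> R.

Definition nclique C := (#|C| == N) && clique C.

Let N_gt0 : 0 < N%:R :> R.
Proof. by move: largeN; lra. Qed.

Let invN : 0 < N%:R^-1 :> R /\ N%:R^-1 <= 1 / (1000 * 1000) :> R.
Proof.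
have t0 : 0 < 1000 * 1000 :> R by lra.
by rewrite invr_gt0 mul1r lef_pV2 ?posrE.
Qed.

Lemma ncliqueP C : nclique C -> [/\ clique C, #|C| = N & (0 < #|C|)%N].
Proof.
by case/andP => /eqP cC clC; split=> //; rewrite cC -(ltr0n R).
Qed.

(** By [clique_split] one side of the cut at 1/2 has at most 108 members. Each of them shifts the
    average by at most 3/N upwards or 1/N downwards, whence 324 and 108. *)
Lemma mean_dichotomy u C (h : R) : form u u <= 3 -> nclique C -> 0 <= h <= 1 / 3 ->
    (forall y, y \in C -> 0 <= form u (ev R y) <= 3 /\
      (form u (ev R y) <= h \/ 1 - h <= form u (ev R y))) ->
  form u (mean R C) <= h + 324 / N%:R \/ 1 - h - 108 / N%:R <= form u (mean R C).
Proof.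
move=> u3 /ncliqueP[clC cC C0] /andP[h0 h3] hC.
pose C1 := [set y in C | 1 / 2 < form u (ev R y)].
pose C2 := [set y in C | form u (ev R y) <= 1 / 2].
have [||||c1|c2] := @clique_split u C1 C2 u3.
- apply/cliqueP => x y xC yC; apply: (cliqueP _ clC).
    by move: xC; rewrite !inE => /orP[] /andP[].
  by move: yC; rewrite !inE => /orP[] /andP[].
- rewrite -setI_eq0; apply/eqP/setP => x; rewrite !inE.
  by case: leP; rewrite ?andbF.
- by move=> y; rewrite inE => /andP[/hC[_ [] ? ?]]; lra.
- by move=> y; rewrite inE => /andP[/hC[_ [] ? ?]]; lra.
- left; rewrite form_mean cC mulrC ler_pdivrMr // mulrDl mulfVK ?gt_eqF //.
  apply: le_trans (_ : _ <= \sum_(y in C) (h + 3 * (y \in C1)%:R)) _.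
    apply: ler_sum => y yC; have [/andP[? ?] hy] := hC _ yC.
    rewrite inE yC /=; case: ltP => /= ? ; rewrite ?mulr1 ?mulr0; lra.
  rewrite big_split sumr_const -mulr_sumr cC mulr_natr lerD2l.
  rewrite -natr_sum -big_mkcondr sum1dep_card.
  have -> : #|[set y in C | y \in C1]| = #|C1|.
    by apply: eq_card => y; rewrite !inE andbA andbb.
  have : #|C1|%:R <= 108 :> R by rewrite ler_nat.
  by lra.
- right; rewrite form_mean cC [X in _ <= X]mulrC ler_pdivlMr // mulrBl mulfVK ?gt_eqF //.
  apply: le_trans (_ : _ <= \sum_(y in C) ((1 - h) + (- 1) * (y \in C2)%:R)) _.
    rewrite big_split sumr_const -mulr_sumr cC mulr_natr lerD2l.
    rewrite -natr_sum -big_mkcondr sum1dep_card.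
    have -> : #|[set y in C | y \in C2]| = #|C2|.
      by apply: eq_card => y; rewrite !inE andbA andbb.
    have : #|C2|%:R <= 108 :> R by rewrite ler_nat.
    by lra.
  apply: ler_sum => y yC; have [/andP[? ?] hy] := hC _ yC.
  rewrite inE yC /=; case: (leP _ (1 / 2)) => /= ?; rewrite ?mulr1 ?mulr0; lra.
Qed.

(** For large cliques both kinds of product turn out to be within 1/1000 of 0 or 1, so 1/2 is just a
    cut inside the gap. *)
Definition near x C := 1 / 2 < form (ev R x) (mean R C).
Definition eqc C D := 1 / 2 < form (mean R C) (mean R D).

Let form_ev3 x y : 0 <= form (ev R x) (ev R y) <= 3.
Proof.
rewrite form_ev; case: (eqVneq x y) => [->|_]; first by rewrite adj_irrefl /=; lra.
by case: adj => /=; lra.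
Qed.

(** Products of basis vectors are 0, 1 or 3, so the dichotomy applies with [h = 0], and 324/N <
    1/2000. *)
Lemma near_small x C : nclique C -> ~~ near x C ->
  0 <= form (ev R x) (mean R C) <= 1 / 2000.
Proof.
move=> nC; rewrite /near -leNgt form_ev_mean_ge0 /= => small.
have [||y yC||] := @mean_dichotomy (ev R x) C 0 _ nC.
- by rewrite form_evxx.
- by lra.
- split; first exact: form_ev3.
  rewrite form_ev; case: (eqVneq x y) => _; case: adj => /=; lra.
- by move: invN; lra.
- by move: invN; lra.
Qed.

Lemma near_big x C : nclique C -> near x C ->
  1 - 1 / 2000 <= form (ev R x) (mean R C) <= 1 + 1 / 2000.
Proof.
move=> nC; rewrite /near => big; have [_ cC C0] := ncliqueP nC.
have := form_ev_mean_le R x C0; rewrite cC => ub.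
have [||y yC||] := @mean_dichotomy (ev R x) C 0 _ nC.
- by rewrite form_evxx.
- by lra.
- split; first exact: form_ev3.
  rewrite form_ev; case: (eqVneq x y) => _; case: adj => /=; lra.
- by move: invN; lra.
- by move: invN ub; lra.
Qed.

Lemma form_mean_norm C : nclique C ->
  1 <= form (mean R C) (mean R C) <= 1 + 1 / 2000.
Proof.
by move=> /ncliqueP[clC cC C0]; rewrite form_meanCC // cC; move: invN; lra.
Qed.

Lemma form_mean_ev3 C x : nclique C -> 0 <= form (mean R C) (ev R x) <= 3 /\
  (form (mean R C) (ev R x) <= 1 / 2000 \/
   1 - 1 / 2000 <= form (mean R C) (ev R x)).
Proof.
move=> nC; rewrite formC; have [/(near_big nC)|/(near_small nC)] := boolP (near x C).
  by move=> h; split; [lra|right; lra].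
by move=> h; split; [lra|left; lra].
Qed.

(** A second use of the dichotomy, with the mean of [C] as [u] and the error 1/2000 of the first use
    as [h]: 1/2000 + 324/N <= 1/1000. *)
Lemma eqc_small C D : nclique C -> nclique D -> ~~ eqc C D ->
  0 <= form (mean R C) (mean R D) <= 1 / 1000.
Proof.
move=> nC nD; rewrite /eqc -leNgt => small; have [_ _ D0] := ncliqueP nD.
apply/andP; split.
  by apply: mean_ge => // y _; have [/andP[]] := form_mean_ev3 y nC.
have := form_mean_norm nC => nn.
have [||y yD||] := @mean_dichotomy (mean R C) D (1 / 2000) _ nD.
- by lra.
- by lra.
- exact: form_mean_ev3.
- by move: invN; lra.
- by move: invN; lra.
Qed.

Lemma eqc_big C D : nclique C -> nclique D -> eqc C D ->
  1 - 1 / 1000 <= form (mean R C) (mean R D) <= 1 + 1 / 1000.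
Proof.
move=> nC nD; rewrite /eqc => big; have [_ _ D0] := ncliqueP nD.
apply/andP; split; last first.
  apply: mean_le => // y _; rewrite formC.
  have [/(near_big nC)|/(near_small nC)] := boolP (near y C); lra.
have := form_mean_norm nC => nn.
have [||y yD||] := @mean_dichotomy (mean R C) D (1 / 2000) _ nD.
- by lra.
- by lra.
- exact: form_mean_ev3.
- by move: invN; lra.
- by move: invN; lra.
Qed.

Lemma eqc_refl C : nclique C -> eqc C C.
Proof. by move=> /form_mean_norm; rewrite /eqc; lra. Qed.

Lemma eqcC C D : eqc C D = eqc D C.
Proof. by rewrite /eqc formC. Qed.

(** The difference of equivalent means [c], [d] has squared norm at most 3/1000. Were the product of
    [u] with [d] small, [u - 2 (c - d)] would have squared norm at most 3 - 4 * 998/1000 + 4 *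
    3/1000 < 0. *)
Lemma eqc_transfer u C D : form u u <= 3 -> nclique C -> nclique D -> eqc C D ->
  999 / 1000 <= form u (mean R C) -> 1 / 1000 < form u (mean R D).
Proof.
move=> u3 nC nD /(eqc_big nC nD) cd uC; rewrite ltNge; apply/negP => uD.
have := psd (u - 2 *: (mean R C - mean R D)); rewrite form_subZ formBr.
rewrite -[X in mean R C - X]scale1r form_subZ.
have := form_mean_norm nC; have := form_mean_norm nD.
by lra.
Qed.

Lemma near_eqc x C D : nclique C -> nclique D -> eqc C D -> near x C -> near x D.
Proof.
move=> nC nD cd /(near_big nC) xC; apply/negPn/negP => /(near_small nD) xD.
have := @eqc_transfer (ev R x) C D; rewrite form_evxx => /(_ _ nC nD cd).
by lra.
Qed.

Lemma eqc_trans C D E : nclique C -> nclique D -> nclique E ->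
  eqc C D -> eqc D E -> eqc C E.
Proof.
move=> nC nD nE cd de; have := eqc_big nC nD cd => cdb.
apply/negPn/negP => /(eqc_small nC nE) ce.
have := form_mean_norm nC => cc.
by have := @eqc_transfer (mean R C) D E _ nD nE de; lra.
Qed.

Lemma mem_near x C : nclique C -> x \in C -> near x C.
Proof.
move=> /ncliqueP[clC cC _] xC; rewrite /near form_ev_meanC // cC.
by move: invN; lra.
Qed.

Lemma adj_near x C : nclique C -> {in C, forall y, adj x y} -> near x C.
Proof.
move=> /ncliqueP[clC cC C0] aC; rewrite /near form_ev_mean //; first by lra.
by apply/negP => /aC; rewrite adj_irrefl.
Qed.

Lemma near_adj x C : nclique C -> near x C -> exists2 y, y \in C & adj x y.
Proof.
move=> nC; have [clC cC C0] := ncliqueP nC => nx.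
apply/exists_inP; apply: contraTT nx => /exists_inPn noadj.
rewrite /near -leNgt form_mean cC mulrC ler_pdivrMr //.
apply: le_trans (_ : _ <= \sum_(y in C) 3 * (x == y)%:R) _.
  by apply: ler_sum => y yC; rewrite form_ev (negbTE (noadj y yC)) add0r.
rewrite -mulr_sumr -natr_sum.
have : (\sum_(y in C) (x == y) <= 1)%N.
  rewrite big_mkcond (bigD1 x) //= big1 => [|y /negbTE]; last first.
    by rewrite eq_sym => ->; case: ifP.
  by case: ifP; rewrite ?eqxx.
by rewrite -(ler_nat R); move: largeN; lra.
Qed.

Lemma near_eqc_subset C D : nclique C -> nclique D ->
  {in D, forall y, near y C} -> eqc C D.
Proof.
move=> nC nD DC; have [_ _ D0] := ncliqueP nD; rewrite /eqc.
suff: 1 - 1 / 2000 <= form (mean R C) (mean R D) by lra.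
by apply: mean_ge => // y yD; rewrite formC; have := near_big nC (DC y yD); lra.
Qed.

End LargeCliques.
End PositiveForm.

(** * Projecting away the fat vertices *)

Section FatTestVector.
Variables (R : realFieldType) (G : sgraph).
Hypothesis psd : forall u : {ffun G -> R^o}, 0 <= form u u.
Variable N : nat.
Hypothesis largeN : 1000 * 1000 <= N%:R :> R.
Variable S : {set {set G}}.
Hypothesis ncliqueS : {in S, forall C, nclique N C}.
Hypothesis neqcS : {in S &, forall C D, C != D -> ~~ eqc R C D}.

(* Test vector: u minus the sum of the s C times the mean of C *)
Lemma form_sub_means (u : {ffun G -> R^o}) (s : {set G} -> R) (L : R) :
    {in S, forall C, `|form u (mean R C) - s C| <= 3 / 1000} ->
    \sum_(C in S) `|s C| <= L ->
  0 <= form u u - \sum_(C in S) s C ^+ 2 + 6 / 1000 * L + L ^+ 2 / 1000.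
Proof.
move=> us sL; pose w := \sum_(C in S) s C *: mean R C.
have uw : \sum_(C in S) s C ^+ 2 - 3 / 1000 * L <= form u w.
  apply: le_trans (_ : _ <= \sum_(C in S) (s C ^+ 2 - 3 / 1000 * `|s C|)) _.
    by rewrite sumrB -mulr_sumr lerD2l lerN2 ler_pM2l //; lra.
  rewrite form_sumr; apply: ler_sum => C CS; rewrite formZr.
  have := us C CS; set q := form _ _ => qs.
  have : `|s C * (q - s C)| <= `|s C| * (3 / 1000).
    by rewrite normrM ler_wpM2l.
  by rewrite ler_norml => /andP[]; lra.
(* The Gram matrix of the means differs from the identity by at most 1/1000 in each entry. *)
have ww : form w w <= \sum_(C in S) s C ^+ 2 + L ^+ 2 / 1000.
  apply: le_trans (_ : _ <= \sum_(C in S) \sum_(D in S)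
      ((C == D)%:R * s C ^+ 2 + `|s C| * `|s D| / 1000)) _.
    rewrite /w form_suml; apply: ler_sum => C CS; rewrite form_sumr.
    apply: ler_sum => D DS; rewrite formZl formZr mulrA.
    rewrite -lerBlDl (le_trans (ler_norm _)) // -normrM.
    have [->|CD] := eqVneq C D.
      have := form_mean_norm largeN (ncliqueS DS); set q := form _ _ => qs.
      have -> : s D * s D * q - 1 * s D ^+ 2 = (s D * s D) * (q - 1) by ring.
      by rewrite [leLHS]normrM ler_wpM2l ?normr_ge0 // ler_norml; lra.
    have := eqc_small psd largeN (ncliqueS CS) (ncliqueS DS) (neqcS CS DS CD).
    set q := form _ _ => qs; rewrite mul0r subr0 [leLHS]normrM ler_wpM2l ?normr_ge0 //.
    by rewrite ler_norml; lra.
  under eq_bigr do rewrite big_split /=.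
  rewrite big_split lerD //=.
    apply: ler_sum => C CS; rewrite (bigD1 C) //= eqxx mul1r big1 ?addr0 //.
    by move=> D /andP[_]; rewrite eq_sym => /negbTE ->; rewrite mul0r.
  have -> : \sum_(C in S) \sum_(D in S) `|s C| * `|s D| / 1000 =
      (\sum_(C in S) `|s C|) ^+ 2 / 1000.
    rewrite expr2 mulr_suml mulr_suml; apply: eq_bigr => C _.
    by rewrite mulr_sumr mulr_suml.
  have T0 : 0 <= \sum_(C in S) `|s C| by apply: sumr_ge0 => C _.
  by rewrite ler_pM2r; [rewrite ler_pXn2r // nnegrE; lra|lra].
have := psd (u - 1 *: w); rewrite form_subZ.
by lra.
Qed.

Definition fats x : {set {set G}} := [set C in S | near R x C].

(** The special matrix plus 3I when the members of [S] are the fat vertices. The entries are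
    integers, so that small errors can be rounded away. *)
Definition redmx x y : int :=
  (adj x y)%:R + 3 * (x == y)%:R - #|fats x :&: fats y|%:R.

Lemma near_err x C : C \in S ->
  `|form (ev R x) (mean R C) - (near R x C)%:R| <= 1 / 1000.
Proof.
move=> /ncliqueS nC; rewrite ler_norml.
have [/(near_big psd largeN nC)|/(near_small psd largeN nC)] := boolP (near R x C).
  by move=> ? /=; lra.
by move=> ? /=; lra.
Qed.

(** The test vector shows this integer to be at least -(6/1000 * 12 + 144/1000) > -1, so it is not
    negative. Here 12 bounds the total absolute weight: three vertices with at most four fat
    neighbors each. *)
Lemma form3_ge0 (x y z : G) (a b c : int) :
    (#|fats x| <= 4)%N -> (#|fats y| <= 4)%N -> (#|fats z| <= 4)%N ->
    `|a| <= 1 -> `|b| <= 1 -> `|c| <= 1 ->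
  0 <= a ^+ 2 * redmx x x + b ^+ 2 * redmx y y + c ^+ 2 * redmx z z +
    2 * (a * b * redmx x y + a * c * redmx x z + b * c * redmx y z).
Proof.
move=> fx fy fz a1 b1 c1.
pose n x (C : {set G}) : R := (near R x C)%:R.
have sn t k : \sum_(C in S) n t C * n k C = #|fats t :&: fats k|%:R.
  rewrite -sum1_card natr_sum (eq_bigl (fun C =>
    (C \in S) && (near R t C && near R k C))).
    rewrite big_mkcondr; apply: eq_bigr => C _; rewrite /n.
    by do 2 case: near; rewrite ?mulr0 ?mul0r ?mulr1.
  by move=> C; rewrite !inE; case: (C \in S).
have sn1 t : \sum_(C in S) n t C = #|fats t|%:R.
  by rewrite -[fats t]setIid -sn; apply: eq_bigr => C _; rewrite /n; case: near;
    rewrite ?mulr0 ?mulr1.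
pose i (k : int) : R := k%:~R.
have i1 k : `|k| <= 1 -> `|i k| <= 1.
  by move=> k1; rewrite -intr_norm -[leRHS](mulr1z (1 : R)) ler_int.
pose s C := i a * n x C + i b * n y C + i c * n z C.
pose u := i a *: ev R x + i b *: ev R y + i c *: ev R z.
have := @form_sub_means u s 12.
have -> : form u u - \sum_(C in S) s C ^+ 2 =
   i (a ^+ 2 * redmx x x + b ^+ 2 * redmx y y + c ^+ 2 * redmx z z +
    2 * (a * b * redmx x y + a * c * redmx x z + b * c * redmx y z)).
  have -> : \sum_(C in S) s C ^+ 2 = \sum_(C in S)
     (i a ^+ 2 * (n x C * n x C) + i b ^+ 2 * (n y C * n y C) +
      i c ^+ 2 * (n z C * n z C) + 2 * (i a * i b) * (n x C * n y C) +
      2 * (i a * i c) * (n x C * n z C) + 2 * (i b * i c) * (n y C * n z C)).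
    by apply: eq_bigr => C _; rewrite /s; ring.
  rewrite !big_split -!mulr_sumr /= !sn /u !(formDl, formDr, formZl, formZr).
  rewrite [form (ev R y) (ev R x)]formC [form (ev R z) (ev R x)]formC.
  rewrite [form (ev R z) (ev R y)]formC !form_ev /i /redmx.
  rewrite !(rmorphD, rmorphB, rmorphM, rmorphXn, rmorph_nat) /=.
  by ring.
set m := (X in i X); move=> h; rewrite leNgt; apply/negP => m0.
have : i m <= -1.
  have: m <= -1 by lia.
  by rewrite -(ler_int R).
suff: 0 <= i m + 6 / 1000 * 12 + 12 ^+ 2 / 1000 by lra.
apply: h => [C CS|].
- have -> : form u (mean R C) - s C = i a * (form (ev R x) (mean R C) - n x C) +
     i b * (form (ev R y) (mean R C) - n y C) +
     i c * (form (ev R z) (mean R C) - n z C).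
    by rewrite /u /s !(formDl, formZl); ring.
  have e t k : `|k| <= 1 -> `|i k * (form (ev R t) (mean R C) - n t C)| <= 1 / 1000.
    move=> /i1 k1; rewrite normrM -[leRHS]mul1r ler_pM //; exact: near_err.
  apply: le_trans (ler_normD _ _) _.
  have := ler_normD (i a * (form (ev R x) (mean R C) - n x C))
     (i b * (form (ev R y) (mean R C) - n y C)).
  by have := e x a a1; have := e y b b1; have := e z c c1; lra.
- apply: le_trans (_ : _ <= \sum_(C in S) (n x C + n y C + n z C)) _.
    apply: ler_sum => C _.
    have e t k : `|k| <= 1 -> `|i k * n t C| <= n t C.
      move=> /i1 k1; rewrite normrM [`|n _ _|]ger0_norm ?ler0n //.
      by rewrite ler_piMl ?ler0n.
    apply: le_trans (ler_normD _ _) _.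
    have := ler_normD (i a * n x C) (i b * n y C).
    by have := e x a a1; have := e y b b1; have := e z c c1; lra.
  rewrite !big_split /= !sn1.
  have le4 k : (k <= 4)%N -> k%:R <= 4 :> R by rewrite -(ler_nat R).
  by have := le4 _ fx; have := le4 _ fy; have := le4 _ fz; lra.
Qed.

End FatTestVector.

(** * Fat vertices *)

(** [common c x x] serves as the set of fat neighbors of [x]. *)
Definition common (G : sgraph) (F : finType) (c : G -> F -> bool) (x y : G) :=
  [set f | c x f && c y f].

(* The entries of S + 3I, where S is the special matrix of the Hoffman graph
   with slim graph G and slim-fat incidence c. *)
Definition reduced (G : sgraph) (F : finType) (c : G -> F -> bool) (x y : G) : int :=
  (adj x y)%:R + 3 * (x == y)%:R - #|common c x y|%:R.

(* M is then, up to a permutation and signs, a direct sum of all-ones and zero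
   matrices. *)
Definition sign_blocks (T : Type) (M : T -> T -> int) : Prop :=
  forall x y z, M x y != 0 -> M x z = M x y * M y z.

Lemma avg_deg_local (R : realType) (G : sgraph) (x : G) :
  avg_deg R (local_graph x) =
  (\sum_(y in neigh x) #|neigh x :&: neigh y|)%:R / (deg x)%:R.
Proof.
rewrite /avg_deg; congr (_%:R / _%:R); last by rewrite /= card_sig.
rewrite (reindex_omap (val : local_graph x -> G) insub) /= => [|y yx]; last first.
  by rewrite insubT.
rewrite [RHS](eq_bigl xpredT) => [|y]; last by rewrite (valP y) /= valK eqxx.
apply: eq_bigr => y _; rewrite /deg -(card_imset _ val_inj).
apply: eq_card => z; apply/imsetP/idP => [[t ty ->]|].
  by rewrite inE (valP t) inE; move: ty; rewrite inE.
rewrite inE => /andP[zx zy]; exists (exist _ z zx) => //.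
by move: zy; rewrite !inE.
Qed.

(** * Choice of the fat vertices and number of fat neighbors *)

Section Representatives.
Variables (R : realType) (G : sgraph).
Hypothesis psd : forall u : {ffun G -> R^o}, 0 <= form u u.
Variable N : nat.
Hypothesis largeN : 1000 * 1000 <= N%:R :> R.

(** The only alternative left by Ramsey's theorem is ten pairwise nonadjacent neighbors of [x],
    which positivity excludes. *)
Lemma nclique_neigh (x : G) (A : {set G}) :
    A \subset neigh x -> (2 ^ (N + 10) <= #|A|)%N ->
  exists2 C : {set G}, nclique N C & C \subset A.
Proof.
move=> sA /(ramsey (@adj_sym G))[[C [sC cC clC]]|[K [sK cK indK]]].
  by exists C => //; rewrite /nclique cC eqxx /=; apply/cliqueP.
(* K_{1,10} has smallest eigenvalue - sqrt 10. *)
have := psd (ev R x - (1 / 3) *: \sum_(y in K) ev R y).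
have xK y : y \in K -> form (ev R x) (ev R y) = 1.
  move=> /(subsetP sK)/(subsetP sA); rewrite inE form_ev => xy.
  rewrite xy (_ : x == y = false) ?mulr0 ?addr0 //.
  by apply/eqP => xy'; rewrite xy' adj_irrefl in xy.
have KK y : y \in K -> \sum_(z in K) form (ev R y) (ev R z) = 3.
  move=> yK; rewrite (bigD1 y) //= form_evxx big1 ?addr0 // => z /andP[zK zy].
  have yz : y != z by rewrite eq_sym.
  by rewrite form_ev (negbTE (indK y z yK zK yz)) (negbTE yz) mulr0 addr0.
rewrite form_subZ form_evxx form_sumr (eq_bigr _ xK) sumr_const cK.
rewrite form_suml; under eq_bigr do rewrite form_sumr.
by rewrite (eq_bigr _ KK) sumr_const cK; lra.
Qed.

Lemma eqc_representatives : exists S : {set {set G}},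
  [/\ {in S, forall C, nclique N C},
      {in S &, forall C D, C != D -> ~~ eqc R C D} &
      forall C, nclique N C -> exists2 D, D \in S & eqc R C D].
Proof.
(* [pick] depends on its predicate only up to extensional equality, so equivalent cliques get the
   same representative. The default [C] is never reached for an N-clique, by reflexivity. *)
pose rep (C : {set G}) := odflt C [pick D | nclique N D && eqc R C D].
have repP C : nclique N C -> nclique N (rep C) /\ eqc R C (rep C).
  move=> nC; rewrite /rep; case: pickP => [D /andP[]//|/(_ C)].
  by rewrite nC (eqc_refl largeN).
have eq_rep C D : nclique N C -> nclique N D -> eqc R C D -> rep C = rep D.
  move=> nC nD CD; rewrite /rep.
  rewrite (@eq_pick _ _ (fun E => nclique N E && eqc R D E)) => [|E]; last first.
    have [nE|//] := boolP (nclique N E); apply/idP/idP => /=; last first.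
      exact: (eqc_trans psd largeN).
    by apply: (eqc_trans psd largeN) => //; rewrite eqcC.
  by case: pickP => //= /(_ D); rewrite nD (eqc_refl largeN).
exists [set rep C | C in nclique N]; split=> [_ /imsetP[C nC ->]|C0 D0|C nC].
- by have [] := repP C nC.
- move=> /imsetP[C nC ->] /imsetP[D nD ->]; apply: contraNN => CD.
  have [nC' CC'] := repP C nC; have [nD' DD'] := repP D nD.
  apply/eqP/eq_rep => //; apply: (eqc_trans psd largeN) CC' _ => //.
  by apply: (eqc_trans psd largeN) CD _ => //; rewrite eqcC.
- by exists (rep C); [apply: imset_f | have [] := repP C nC].
Qed.

Variable S : {set {set G}}.
Hypothesis ncliqueS : {in S, forall C, nclique N C}.
Hypothesis neqcS : {in S &, forall C D, C != D -> ~~ eqc R C D}.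
Hypothesis repS : forall C, nclique N C -> exists2 D, D \in S & eqc R C D.

(** Four fat neighbors would give the diagonal entry 3 - 4 < 0. As [form3_ge0] admits no more than
    four, it is applied to a set [A] of exactly four of them in place of [S]. *)
Lemma fats_le3 x : (#|fats R S x| <= 3)%N.
Proof.
rewrite leqNgt; apply/negP => gt3.
pose A := [set C in take 4 (enum (fats R S x))].
have sA : A \subset fats R S x.
  by apply/subsetP => C; rewrite inE => /mem_take; rewrite mem_enum.
have AS : {subset A <= S} by move=> C /(subsetP sA); rewrite inE => /andP[].
have fA : fats R A x = A.
  apply/setP => C; rewrite inE andb_idr // => /(subsetP sA).
  by rewrite inE => /andP[].
have cA : #|A| = 4%N.
  rewrite cardsE; have /card_uniqP -> := take_uniq 4 (enum_uniq (fats R S x)).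
  by rewrite size_takel // -cardE.
have nA : {in A, forall C, nclique N C} by move=> C /AS; apply: ncliqueS.
have dA : {in A &, forall C D, C != D -> ~~ eqc R C D}.
  by move=> C D /AS CS /AS; apply: neqcS.
have := @form3_ge0 R G psd N largeN A nA dA x x x 1 0 0.
rewrite fA cA => /(_ isT isT isT isT isT isT).
by rewrite /redmx fA setIid cA adj_irrefl eqxx.
Qed.

(** Two fat neighbors make the diagonal at most 1. If [Mxy] is nonzero, it is then a sign and
    [x - Mxy y] has norm 0. This vector is orthogonal to [z], since otherwise adding or subtracting
    [z], of norm at most 1, would give a negative norm. *)
Lemma sign_blocks_redmx : (forall x, 2 <= #|fats R S x|)%N ->
  sign_blocks (redmx R S).
Proof.
move=> ge2 x y z Mxy0.
have le4 t : (#|fats R S t| <= 4)%N by apply: leqW; apply: fats_le3.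
have psd3 := fun a b c => @form3_ge0 R G psd N largeN S ncliqueS neqcS x y z a b c
  (le4 _) (le4 _) (le4 _).
have Mle1 t : redmx R S t t <= 1.
  by rewrite /redmx setIid eqxx adj_irrefl; have := ge2 t; lia.
have := Mle1 x; have := Mle1 y; have := Mle1 z; move: psd3 Mxy0.
set Mxx := redmx R S x x; set Myy := redmx R S y y; set Mzz := redmx R S z z.
set Mxy := redmx R S x y; set Mxz := redmx R S x z; set Myz := redmx R S y z.
move=> psd3 Mxy0 Mzz1 Myy1 Mxx1.
have := psd3 1 1 0 isT isT isT; have := psd3 1 (-1) 0 isT isT isT.
have := psd3 1 1 1 isT isT isT; have := psd3 1 (-1) 1 isT isT isT.
have := psd3 1 1 (-1) isT isT isT; have := psd3 1 (-1) (-1) isT isT isT.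
rewrite !expr2.
move=> h1 h2 h3 h4 h5 h6.
have [E|E] : Mxy = 1 \/ Mxy = -1 by lia.
  by rewrite E; lia.
by rewrite E; lia.
Qed.

(** If [x] had only one fat neighbor [F], nearly all neighbors of [x] would be near [F] and adjacent
    to nearly all the others. The local average degree would be at least [deg x - 3 r], where [r] is
    the Ramsey bound of [nclique_neigh]. *)
Lemma fats_ge2 x : (3 * 2 ^ (N + 10) + 1 < deg x)%N ->
    avg_deg R (local_graph x) <= (deg x)%:R - (3 * 2 ^ (N + 10) + 1)%:R ->
  (2 <= #|fats R S x|)%N.
Proof.
set r := (2 ^ (N + 10))%N => large_deg; rewrite avg_deg_local => avg_le.
rewrite leqNgt; apply/negP => lt2.
have rle (A : {set G}) : A \subset neigh x -> (r <= #|A|)%N ->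
    exists2 C : {set G}, nclique N C & C \subset A by exact: nclique_neigh.
clearbody r.
have fat_of C : nclique N C -> C \subset neigh x ->
    exists2 D, D \in fats R S x & eqc R C D.
  move=> nC sC; have [D DS CD] := repS nC; exists D => //.
  rewrite inE DS (near_eqc psd largeN nC (ncliqueS DS) CD) //.
  by apply: (adj_near largeN) => // y /(subsetP sC); rewrite inE.
have rdeg : (r <= #|neigh x|)%N by move: large_deg; rewrite /deg; lia.
have [C0 nC0 sC0] := rle (neigh x) (subxx _) rdeg.
have [F Fx C0F] := fat_of C0 nC0 sC0.
have FS : F \in S by move: Fx; rewrite inE => /andP[].
have nF := ncliqueS FS.
have uniqF D : D \in fats R S x -> D = F.
  by move=> Dx; apply/eqP; have /card_le1_eqP := lt2; move/(_ D F Dx Fx) ->.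
(* An N-clique inside [B] would be equivalent to [F], so its members would be near [F]. *)
pose B := [set y in neigh x | ~~ near R y F].
have Bsmall : (#|B| < r)%N.
  rewrite ltnNge; apply/negP => /rle[|C nC sC].
    by apply/subsetP => y; rewrite !inE => /andP[].
  have [|D /uniqF -> CF] := fat_of C nC.
    by apply/subsetP => y /(subsetP sC); rewrite !inE => /andP[].
  have [_ _ /card_gt0P[y yC]] := ncliqueP largeN nC.
  have := subsetP sC y yC; rewrite inE => /andP[_ /negP]; apply.
  by apply: (near_eqc psd largeN nC nF CF); apply: (mem_near largeN).
(* An N-clique of neighbors of [x] near [F] but not adjacent to [y] would be equivalent to [F],
   hence [y] would be near it and adjacent to one of its members. So [y] misses fewer than [r]
   vertices outside [B], and fewer than [r] inside. *)
have deg_near y : y \in neigh x -> near R y F ->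
    (deg x <= #|neigh x :&: neigh y| + (r + r))%N.
  move=> yx yF; rewrite /deg -(cardsID (neigh y)) leq_add2l.
  pose Z := [set z in neigh x | near R z F && ~~ adj y z].
  have Zsmall : (#|Z| < r)%N.
    rewrite ltnNge; apply/negP => /rle[|C nC sC].
      by apply/subsetP => z; rewrite !inE => /andP[].
    have FC : eqc R F C.
      apply: (near_eqc_subset psd largeN) => // z /(subsetP sC).
      by rewrite !inE => /and3P[].
    have := near_eqc psd largeN nF nC FC yF.
    move/(near_adj largeN nC) => [z /(subsetP sC)].
    by rewrite !inE => /and3P[_ _ /negbTE ->].
  apply: (@leq_trans (#|B| + #|Z|)); last by rewrite leq_add // ltnW.
  rewrite -cardsUI; apply: leq_trans (leq_addr _ _).
  apply: subset_leq_card; apply/subsetP => z; rewrite !inE => /andP[zy ->].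
  by rewrite zy andbT orNb.
(* The third [r] pays for the members of [B], whose local degree may be 0. *)
have sum_ge : (deg x * deg x <=
    \sum_(y in neigh x) #|neigh x :&: neigh y| + 3 * r * deg x)%N.
  have -> : (deg x * deg x = \sum_(y in neigh x) deg x)%N.
    by rewrite sum_nat_const.
  apply: leq_trans (_ : _ <= \sum_(y in neigh x) (#|neigh x :&: neigh y| +
      (r + r) + (y \in B) * deg x))%N _.
    apply: leq_sum => y yx; have [yF|yF] := boolP (near R y F).
      by rewrite (leq_trans (deg_near y yx yF)) // leq_addr.
    by rewrite inE yx yF mul1n leq_addl.
  rewrite !big_split /= -addnA leq_add2l -big_distrl /= sum_nat_const.
  have -> : (\sum_(y in neigh x) (y \in B) = #|B|)%N.
    rewrite -sum1_card big_mkcond [RHS]big_mkcond; apply: eq_bigr => y _.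
    by rewrite !inE; case: adj => //=; case: near.
  have -> : #|neigh x| = deg x by [].
  by move: #|B| (deg x) Bsmall; clear=> b d Bsmall; nia.
have deg0 : 0 < (deg x)%:R :> R by rewrite ltr0n (leq_trans _ large_deg).
move: avg_le; rewrite ler_pdivrMr // mulrBl -natrM -natrM lerBrDr -natrD ler_nat.
move: (\sum_(_ in _) _)%N (deg x) large_deg sum_ge; clear=> s d large_deg sum_ge.
by nia.
Qed.

End Representatives.

Lemma form_psd (R : realType) (G : sgraph) : - 3 <= lambda_min R G ->
  forall u : {ffun G -> R^o}, 0 <= form u u.
Proof.
move=> minG u; have := adj_quad_ge minG u.
suff -> : form u u = \sum_x \sum_y u x * u y * (adj x y)%:R + 3 * \sum_x u x ^+ 2.
  by move=> h; lra.
rewrite /form mulr_sumr -big_split; apply: eq_bigr => x _ /=.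
transitivity (\sum_y (u x * u y * (adj x y)%:R + 3 * (u x * u y * (x == y)%:R))).
  by apply: eq_bigr => y _; ring.
rewrite big_split -mulr_sumr; congr (_ + 3 * _).
rewrite (bigD1 x) //= eqxx mulr1 big1 ?addr0 // => y /negbTE.
by rewrite eq_sym => ->; rewrite mulr0.
Qed.

Lemma fat_structure (R : realType) :
  exists kappa : nat, (0 < kappa)%N /\
    forall G : sgraph,
      (forall x : G, (kappa < deg x)%N) ->
      (forall x : G, avg_deg R (local_graph x) <= (deg x)%:R - kappa%:R) ->
      - 3%:R <= lambda_min R G ->
    exists (F : finType) (c : G -> F -> bool),
      [/\ forall f, exists x, c x f, forall x, (2 <= #|common c x x|)%N &
          sign_blocks (reduced c)].
Proof.
have [N largeN] : exists N : nat, 1000 * 1000 <= N%:R :> R.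
  by exists (1000 * 1000)%N; rewrite natrM.
(* Three Ramsey bounds for the degrees lost in [fats_ge2], and one more to make the contradiction
   strict. *)
exists (3 * 2 ^ (N + 10) + 1)%N; split=> [|G degG avgG /form_psd psd].
  by rewrite addn1.
have [S [nS dS rS]] := eqc_representatives psd largeN.
pose c (x : G) (f : {C | C \in S}) := near R x (val f).
have commonE x y : #|common c x y| = #|fats R S x :&: fats R S y|.
  rewrite -(card_imset _ val_inj); apply: eq_card => C; rewrite !inE.
  apply/imsetP/idP => [[f + ->]|]; first by rewrite inE /c (valP f).
  case/andP => /andP[CS Cx] /andP[_ Cy]; exists (exist _ C CS) => //.
  by rewrite inE /c /= Cx.
have ge2 x : (2 <= #|fats R S x|)%N.
  by apply: (fats_ge2 psd largeN nS rS); [apply: degG|apply: avgG].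
exists {C | C \in S}, c; split=> [f|x|x y z].
- have nC := nS _ (valP f); have [_ _ /card_gt0P[x xC]] := ncliqueP largeN nC.
  by exists x; apply: (mem_near largeN).
- by rewrite commonE setIid.
- rewrite /reduced !commonE.
  exact: (sign_blocks_redmx psd largeN nS dS ge2).
Qed.

(** * Blocks of S + 3I *)

Section SignBlocks.
Variables (T : Type) (M : T -> T -> int).
Hypotheses (M_sym : forall x y, M x y = M y x) (blocksM : sign_blocks M).

Lemma sign_blocks_diag x y : M x y != 0 -> M x x = 1.
Proof.
move=> xy; have xx := blocksM x xy; rewrite (M_sym y) in xx.
have : M x x != 0 by rewrite xx mulf_neq0.
by move=> /[dup] /(blocksM x); nia.
Qed.

Lemma sign_blocks_sign x y : M x y != 0 -> M x y = 1 \/ M x y = -1.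
Proof.
move=> xy; have := sign_blocks_diag xy; rewrite (blocksM x xy) (M_sym y x).
by nia.
Qed.

End SignBlocks.

Lemma reduced_sym (G : sgraph) (F : finType) (c : G -> F -> bool) x y :
  reduced c x y = reduced c y x.
Proof.
rewrite /reduced adj_sym eq_sym; congr (_ - _%:R).
by apply: eq_card => f; rewrite !inE andbC.
Qed.

(* An all-ones block of order at least 3 does not come from f1, f2 or f3; one
   more fat vertex adjacent to all its members turns it into copies of f1. *)
Lemma fat_extension (G : sgraph) (F : finType) (c : G -> F -> bool) :
    (forall f, exists x, c x f) -> (forall x, (2 <= #|common c x x|)%N) ->
    sign_blocks (reduced c) ->
  exists (F' : finType) (c' : G -> F' -> bool),
    [/\ forall f, exists x, c' x f, forall x, (2 <= #|common c' x x|)%N,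
        sign_blocks (reduced c') &
        forall x, reduced c' x x != 0 -> exists y, reduced c' x y < 0].
Proof.
set M := reduced c => surj ge2 blocksM.
have M_sym x y : M x y = M y x by apply: reduced_sym.
have M_diag := sign_blocks_diag M_sym blocksM.
have M_sign := sign_blocks_sign M_sym blocksM.
(* [pos x] says that the block of [x] is all-ones, possibly of order 1. Each such block becomes a
   new fat vertex in [F']. *)
pose pos x := (M x x != 0) && [forall y, 0 <= M x y].
pose blk x := [set y | M x y != 0].
pose Bs := [set blk x | x in pos].
pose F' : finType := (F + {B | B \in Bs})%type.
pose c' x (f : F') := match f with inl f => c x f | inr B => x \in val B end.
have blk_eq x y : M x y != 0 -> blk x = blk y.
  move=> xy; apply/setP => z; rewrite !inE (blocksM x y z xy).
  by rewrite mulf_eq0 (negbTE xy).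
have pos_eq x y : M x y != 0 -> pos x -> pos y.
  move=> xy /andP[_ /forallP x0]; have yx : M y x != 0 by rewrite M_sym.
  rewrite /pos (M_diag _ _ yx) /=; apply/forallP => z.
  rewrite (blocksM y x z yx) mulr_ge0 // M_sym; exact: x0.
have posP x y : pos x -> M x y != 0 -> M x y = 1.
  by move=> /andP[_ /forallP/(_ y) h] /M_sign[//|E]; rewrite E in h.
have BsP x B : B \in Bs -> (x \in B) = pos x && (B == blk x).
  case/imsetP => z pz ->; rewrite inE; apply/idP/andP => [zx|[/andP[xx _] /eqP zx]].
    by rewrite (pos_eq _ _ zx pz) (blk_eq _ _ zx) eqxx.
  have xx' : x \in blk x by rewrite inE.
  by move: xx'; rewrite -zx inE.
have common' x y : #|common c' x y| = (#|common c x y| + (pos x && (M x y != 0)))%N.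
  have -> : common c' x y = [set inl f | f in common c x y] :|:
      [set inr B | B in [set B : {B | B \in Bs} | (x \in val B) && (y \in val B)]].
    apply/setP => -[f|B]; rewrite !inE /=.
      rewrite [X in _ = X || _](mem_imset _ _ (@inl_inj _ _)) inE.
      by case: imsetP => [[? _ //]|_]; rewrite orbF.
    rewrite [X in _ = _ || X](mem_imset _ _ (@inr_inj _ _)) inE.
    by case: imsetP => [[? _ //]|_].
  rewrite cardsU [X in (_ - X)%N](_ : _ = 0)%N ?subn0; last first.
    apply/eqP; rewrite cards_eq0; apply/eqP/setP => f; rewrite !inE.
    by apply/negP => /andP[/imsetP[a _ ->] /imsetP[]].
  rewrite card_imset; last exact: inl_inj.
  rewrite card_imset; last exact: inr_inj.
  congr (_ + _)%N; have [/andP[px xy]|npx] := boolP (_ && _).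
    have xB : blk x \in Bs by apply: imset_f.
    rewrite -[RHS](cards1 (exist _ (blk x) xB : {B | B \in Bs})).
    apply: eq_card => B.
    rewrite !inE -val_eqE /= (BsP x) ?(BsP y) ?(valP B) //.
    by rewrite px (pos_eq _ _ xy px) -(blk_eq _ _ xy) andbb.
  apply/eqP; rewrite cards_eq0; apply/eqP/setP => B; rewrite !inE.
  rewrite (BsP x) ?(valP B) //; apply/negP => /andP[/andP[px /eqP ->]].
  by rewrite inE => xy; rewrite px xy in npx.
(* The new fat vertex lowers the entries of its block from 1 to 0 and changes no others. *)
have M' x y : reduced c' x y = if pos x then 0 else M x y.
  rewrite /reduced common' natrD opprD addrA -/(reduced c x y) -/M.
  case: ifP => px /=; last by rewrite subr0.
  have [->|xy] := eqVneq (M x y) 0; first by rewrite subr0.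
  by rewrite (posP _ _ px xy) subrr.
exists F', c'; split.
- move=> [f|B] /=; first exact: surj.
  by have /imsetP[z /andP[zz _] ->] := valP B; exists z; rewrite inE.
- by move=> x; rewrite common' (leq_trans (ge2 x)) // leq_addr.
- move=> x y z; rewrite !M'; case: ifP => px; rewrite ?eqxx // => xy.
  case: ifP => py; last exact: blocksM.
  by rewrite (pos_eq y x) // in px; rewrite M_sym.
- move=> x; rewrite M'; case: ifP => px; rewrite ?eqxx // => xx.
  move: px; rewrite /pos xx => /negbT/forallPn[y]; rewrite -ltNge => xy.
  by exists y; rewrite M' /pos xx; case: forallP => // /(_ y); rewrite leNgt xy.
Qed.

(* Incidence-level form of: the Hoffman graph generated by E embeds into the
   one with slim graph e and incidence i. *)
Definition embeds (G : sgraph) (F S K : finType) (c : G -> F -> bool) (E : {set G})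
    (e : rel S) (i : S -> K -> bool) : Prop :=
  exists (s : G -> S) (p : F -> K),
    [/\ {in E &, injective s},
        {in \bigcup_(x in E) common c x x &, injective p},
        {in E &, forall x y, adj x y = e (s x) (s y)} &
        {in E & \bigcup_(x in E) common c x x, forall x f, c x f = i (s x) (p f)}].

(** * Embedding the blocks into f1, f2 and f3 *)

Section Blocks.
Variables (G : sgraph) (F : finType) (c : G -> F -> bool).
Local Notation M := (reduced c).
Local Notation D x := (common c x x).
Hypotheses (blocksM : sign_blocks M)
  (negM : forall x, M x x != 0 -> exists y, M x y < 0).

Let M_sym := @reduced_sym G F c.
Let M_diag := sign_blocks_diag M_sym blocksM.
Let M_sign := sign_blocks_sign M_sym blocksM.

(** The first disjunct keeps [x] in its block when [M x x = 0]. *)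
Definition block x : {set G} := [set y | (x == y) || (M x y != 0)].

Let mem_D x f : (f \in D x) = c x f.
Proof. by rewrite inE andbb. Qed.

Let commonI x y : common c x y = D x :&: D y.
Proof. by apply/setP => f; rewrite !inE !andbb. Qed.

Let reduced_diag x : M x x = 3 - #|D x|%:R.
Proof. by rewrite /reduced adj_irrefl eqxx. Qed.

Let card_D x y : M x y != 0 -> #|D x| = 2%N.
Proof. by move=> /M_diag; rewrite reduced_diag; lia. Qed.

(** A zero diagonal entry means three fat neighbors, which the map to ['I_3] numbers, and makes the
    whole row zero. *)
Lemma block_singleton x : M x x = 0 -> embeds c (block x) f1_slim f1_inc.
Proof.
move=> xx; have bx : block x = [set x].
  apply/setP => y; rewrite !inE eq_sym; case: eqP => //= _.
  by apply/negbTE/negP => /M_diag; rewrite xx.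
have cD : #|D x| = 3%N by move: xx; rewrite reduced_diag; lia.
exists (fun=> tt), (fun f => inord (index f (enum (D x)))).
rewrite bx big_set1; split.
- by move=> y z /set1P -> /set1P ->.
- move=> f g fx gx /(congr1 (@nat_of_ord _)).
  have lt3 t : t \in D x -> (index t (enum (D x)) < 3)%N.
    by move=> tx; rewrite -cD cardE index_mem mem_enum.
  by rewrite !inordK ?lt3 // => /index_inj -> //; rewrite mem_enum.
- by move=> y z /set1P -> /set1P ->; rewrite adj_irrefl.
- by move=> y f /set1P ->; rewrite mem_D => ->.
Qed.

(** Off the diagonal an entry is the adjacency minus the number of common fat neighbors. So 1 forces
    adjacency and disjointness, while -1 forces two common fat neighbors for an adjacent pair and
    one otherwise. *)
Let pos_disjoint z t : z != t -> M z t = 1 ->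
  adj z t /\ forall f, f \in D z -> f \in D t -> False.
Proof.
move=> /negbTE zt; rewrite /reduced zt mulr0 addr0 commonI.
case: adj => /=; last by lia.
move=> h; split=> // f fz ft.
have : (0 < #|D z :&: D t|)%N by apply/card_gt0P; exists f; rewrite inE fz.
by lia.
Qed.

Let neg_neq z t : M z t = -1 -> z != t.
Proof.
move=> zt; apply/eqP => E; have := @M_diag z t; rewrite zt => /(_ isT).
by rewrite [X in M _ X]E zt.
Qed.

Let neg_common z t : M z t = -1 -> #|D z :&: D t| = (1 + adj z t)%N.
Proof.
move=> zt; move: (zt); rewrite /reduced (negbTE (neg_neq zt)) commonI.
by case: adj => /=; lia.
Qed.

Let neg_meet z t : M z t = -1 -> exists2 f, f \in D z & f \in D t.
Proof.
move=> /neg_common zt; have /card_gt0P[f] : (0 < #|D z :&: D t|)%N by rewrite zt.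
by rewrite inE => /andP[]; exists f.
Qed.

Let three (A : {set F}) f g h : #|A| = 2%N -> f \in A -> g \in A -> h \in A ->
  f != g -> f != h -> g != h -> False.
Proof.
move=> cA fA gA hA fg fh gh; suff: (2 < #|A|)%N by rewrite cA.
apply/card_geqP; exists [:: f; g; h]; split=> //=.
  by rewrite !inE negb_or fg fh gh.
by move=> t; rewrite !inE => /or3P[] /eqP ->.
Qed.

Let neq_of (A : {set F}) f g : f \in A -> (g \in A -> False) -> f != g.
Proof. by move=> fA gA; apply/eqP => fg; apply: gA; rewrite -fg. Qed.

(** [z] and [t] share both of their two fat neighbors. A third member of the block would have entry
    1 with one of them and -1 with the other, hence would be disjoint from the one and meet the
    other. *)
Lemma adj_neg_block z t w : M z t = -1 -> adj z t -> M z w != 0 -> w = z \/ w = t.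
Proof.
move=> zt azt zw; have zt0 : M z t != 0 by rewrite zt.
have tz0 : M t z != 0 by rewrite M_sym.
have DE : D z = D t.
  have /eqP E : D z :&: D t == D z.
    by rewrite eqEcard subsetIl neg_common // azt (card_D zt0).
  have /eqP : D z :&: D t == D t.
    by rewrite eqEcard subsetIr neg_common // azt (card_D tz0).
  by rewrite E.
have tw := blocksM w tz0; rewrite (M_sym t z) zt mulN1r in tw.
have [->|wz] := eqVneq w z; [by left|]; have [->|wt] := eqVneq w t; [by right|].
rewrite eq_sym in wz; rewrite eq_sym in wt.
have [zw1|zw1] := M_sign zw.
  have [_ dzw] := pos_disjoint wz zw1; rewrite zw1 in tw.
  by have [f] := neg_meet tw; rewrite -DE => /dzw.
rewrite zw1 opprK in tw; have [_ dtw] := pos_disjoint wt tw.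
by have [f] := neg_meet zw1; rewrite DE => /dtw.
Qed.

Section NegativePair.
Variables x y : G.
Hypothesis xy : M x y = -1.

Let xy0 : M x y != 0. Proof. by rewrite xy. Qed.
Let xx : M x x = 1. Proof. exact: M_diag xy0. Qed.

Let block_neq0 z : z \in block x -> M x z != 0.
Proof. by rewrite inE => /orP[/eqP <-|//]; rewrite xx. Qed.

Let M_block z t : z \in block x -> M z t = M x z * M x t.
Proof.
by move=> /block_neq0 xz; rewrite (@blocksM z x t) (M_sym z x).
Qed.

Let My z : M y z = - M x z.
Proof. by rewrite (@blocksM y x) (M_sym y x) xy ?mulN1r. Qed.

Let mem_block z : M x z != 0 -> z \in block x.
Proof. by rewrite inE => ->; rewrite orbT. Qed.

(** The block is just the pair [x], [y] with two common fat neighbors; an arbitrary one of these,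
    [f0], tells them apart. *)
Lemma block_adjacent : adj x y -> embeds c (block x) f3_slim f3_inc.
Proof.
move=> axy; have blkP z : z \in block x -> z = x \/ z = y.
  by move=> /block_neq0; apply: adj_neg_block.
have cI : #|D x :&: D y| = 2%N by rewrite neg_common // axy.
have cx := card_D xy0; have cy : #|D y| = 2%N by apply: (@card_D y x); rewrite M_sym.
have DE : D x = D y.
  have /eqP E : D x :&: D y == D x by rewrite eqEcard subsetIl cI cx.
  have /eqP : D x :&: D y == D y by rewrite eqEcard subsetIr cI cy.
  by rewrite E.
have nxy := neg_neq xy; have /negbTE nyx : y != x by rewrite eq_sym.
have [f0 f0x] : exists f0, f0 \in D x by apply/card_gt0P; rewrite cx.
have memD f : f \in \bigcup_(z in block x) D z -> f \in D x.
  by case/bigcupP => z /blkP[] -> //; rewrite DE.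
exists (fun z => z == x), (fun f => f == f0); split.
- by move=> z t /blkP[] -> /blkP[] ->; rewrite ?eqxx ?nyx.
- move=> f g /memD fx /memD gx.
  have [->|ff0] := eqVneq f f0; first by move/esym/eqP.
  move/esym/negbT => gf0; apply/eqP/negPn/negP => fg.
  exact: (three cx fx gx f0x fg ff0 gf0).
- move=> z t /blkP[] -> /blkP[] ->; rewrite ?adj_irrefl ?(adj_sym y x) ?axy;
    by rewrite /f3_slim ?eqxx ?nyx.
- move=> z f zb /memD fx; rewrite -mem_D /f3_inc.
  by case: (blkP z zb) => ->; rewrite -?DE fx.
Qed.

Hypothesis nadj_xy : ~~ adj x y.

(** An adjacent pair with entry -1 is a whole block by [adj_neg_block], so it would be the
    nonadjacent pair [x], [y]. *)
Let neg_common1 z t : z \in block x -> M z t = -1 -> #|D z :&: D t| = 1%N.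
Proof.
move=> zb zt; rewrite neg_common //.
suff /negbTE -> : ~~ adj z t by [].
apply: contra nadj_xy => azt.
have zx0 : M z x != 0 by rewrite M_sym block_neq0.
have zy0 : M z y != 0 by rewrite M_sym My oppr_eq0 block_neq0.
have := neg_neq xy; case: (adj_neg_block zt azt zx0) => ->;
  case: (adj_neg_block zt azt zy0) => ->; rewrite ?eqxx //.
by rewrite adj_sym.
Qed.

(** Each side of the block has at most two members: three would have pairwise disjoint fat
    neighborhoods, all meeting the two-element [D b]. *)
Let pos_unique a b z w : M a b = -1 -> a != z -> M a z = 1 -> M a w = 1 ->
  w = a \/ w = z.
Proof.
move=> ab az az1 aw1; have aw0 : M a w != 0 by rewrite aw1.
have az0 : M a z != 0 by rewrite az1.
have [->|wa] := eqVneq w a; [by left|]; have [->|wz] := eqVneq w z; [by right|].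
rewrite eq_sym in wa; rewrite eq_sym in wz.
have ba0 : M b a != 0 by rewrite M_sym ab.
have ba : M b a = -1 by rewrite M_sym.
have bz : M b z = -1 by rewrite (blocksM z ba0) ba az1.
have bw : M b w = -1 by rewrite (blocksM w ba0) ba aw1.
have zw1 : M z w = 1.
  by rewrite (@blocksM z a) (M_sym z a) az1 // aw1.
have [_ daz] := pos_disjoint az az1; have [_ daw] := pos_disjoint wa aw1.
have [_ dzw] := pos_disjoint wz zw1.
have [f fb fa] := neg_meet ba; have [g gb gz] := neg_meet bz.
have [h hb hw] := neg_meet bw; exfalso.
apply: (three (card_D ba0) fb gb hb).
- by apply: (neq_of fa) => /daz; apply.
- by apply: (neq_of fa) => /daw; apply.
- by apply: (neq_of gz) => /dzw; apply.
Qed.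

(** [D a] and [D z] are disjoint. They cover [D w]: a member [w] on their side is [a] or [z], and
    one on the other side meets both, which uses up its two fat neighbors. *)
Let cover a b z w f : M a b = -1 -> a != z -> M a z = 1 -> M a w != 0 ->
  f \in D w -> c z f = ~~ c a f.
Proof.
move=> ab az az1 aw0 fw; have [_ daz] := pos_disjoint az az1.
have za : M z a = 1 by rewrite M_sym.
have za0 : M z a != 0 by rewrite za.
have zw : M z w = M a w by rewrite (blocksM w za0) za mul1r.
rewrite -!mem_D; have [fa|fa] := boolP (f \in D a).
  by apply/negP => /(daz f fa).
apply/negPn/negP => fz.
have [aw1|aw1] := M_sign aw0.
  by case: (pos_unique ab az az1 aw1) => E; rewrite -E fw in fa fz.
rewrite aw1 in zw; have [g ga gw] := neg_meet aw1; have [h hz hw] := neg_meet zw.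
have wa0 : M w a != 0 by rewrite M_sym.
apply: (three (card_D wa0) fw gw hw).
- by rewrite eq_sym; apply: (neq_of ga); apply/negP.
- by rewrite eq_sym; apply: (neq_of hz); apply/negP.
- by apply: (neq_of ga) => /daz; apply.
Qed.

(* x and y become (false, false) and (true, true); another member of the block
   lies on the side of the one of x, y with which its entry is 1. *)
Lemma block_nonadjacent : embeds c (block x) f2_slim f2_inc.
Proof.
pose s z : bool * bool := if M x z < 0 then (true, z == y) else (false, z != x).
pose p f : bool * bool := (~~ c x f, c y f).
have yx : M y x = -1 by rewrite M_sym.
have sP z : z \in block x -> (M x z = 1 /\ s z = (false, z != x)) \/
    (M x z = -1 /\ s z = (true, z == y)).
  by move=> /block_neq0/M_sign[] E; rewrite /s E; [left|right].
(* A fat vertex is coded by its incidence with [x] and [y]; by [cover], the other member of either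
   side has the complementary incidence. *)
have inc : {in block x & \bigcup_(z in block x) D z,
    forall z f, c z f = f2_inc (s z) (p f)}.
  move=> z f zb /bigcupP[w wb fw]; have xw := block_neq0 wb.
  have [[xz ->]|[xz ->]] := sP z zb; rewrite /f2_inc /p /=.
    have [->|zx] := eqVneq z x; first by case: c.
    by rewrite (cover xy _ xz xw fw) 1?eq_sym //; case: c.
  have [->|zy] := eqVneq z y; first by case: c.
  have yz : M y z = 1 by rewrite My xz.
  have yw : M y w != 0 by rewrite My oppr_eq0.
  by rewrite (cover yx _ yz yw fw) 1?eq_sym //; case: c.
have s_inj : {in block x &, injective s}.
  move=> z t zb tb.
  have [[xz ->]|[xz ->]] := sP z zb; have [[xt ->]|[xt ->]] := sP t tb => // -[].
    have [->|zx] := eqVneq z x; first by move/esym/eqP.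
    rewrite eq_sym in zx => tx; have := pos_unique xy zx xz xt.
    by case=> // tx'; rewrite tx' eqxx in tx.
  have [->|zy] := eqVneq z y; first by move/esym/eqP.
  rewrite eq_sym in zy => ty.
  have yz : M y z = 1 by rewrite My xz.
  have yt : M y t = 1 by rewrite My xt.
  have := pos_unique yx zy yz yt.
  by case=> // ty'; rewrite ty' eqxx in ty.
exists s, p; split=> //.
(* Fat vertices [f], [g] with the same image have the same neighbors in the block. If they were
   distinct, they would form [D w], and [D t] for [t] on the other side would contain both or
   neither, although it meets [D w] in one element. *)
- move=> f g fb gb fg.
  have same z : z \in block x -> (f \in D z) = (g \in D z).
    by move=> zb; rewrite !mem_D !inc // fg.
  have /bigcupP[w wb fw] := fb.
  have [t [tb wt]] : exists t, t \in block x /\ M w t = -1.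
    have [[xw _]|[xw _]] := sP w wb.
      by exists y; rewrite mem_block // M_sym My xw.
    by exists x; rewrite mem_block ?xx // M_sym.
  have := neg_common1 wb wt; have := same w wb; rewrite fw => /esym gw.
  have w0 : M w t != 0 by rewrite wt.
  have cw := card_D w0; have := same t tb.
  have [ft|ft] := boolP (f \in D t) => /esym gt cI.
    have /card_le1_eqP le1 : (#|D w :&: D t| <= 1)%N by rewrite cI.
    by apply: le1; rewrite inE ?fw ?gw.
  have /card_gt0P[h] : (0 < #|D w :&: D t|)%N by rewrite cI.
  rewrite inE => /andP[hw ht]; apply/eqP/negPn/negP => fg'.
  apply: (three cw fw gw hw fg').
    by rewrite eq_sym; apply: (neq_of ht); apply/negP.
  by rewrite eq_sym; apply: (neq_of ht); rewrite gt.
- move=> z t zb tb; have [->|zt] := eqVneq z t.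
    by rewrite adj_irrefl f2_slim_irrefl.
  have szt : s z != s t by apply: contra zt => /eqP/s_inj ->.
  have nadj : M z t = -1 -> adj z t = false.
    move=> ztN; have := neg_common1 zb ztN; rewrite neg_common //.
    by case: adj.
  have yadj : M z t = 1 -> adj z t by move=> /(pos_disjoint zt)[].
  move: szt (M_block t zb) nadj yadj.
  have [[xz ->]|[xz ->]] := sP z zb; have [[xt ->]|[xt ->]] := sP t tb;
    rewrite /f2_slim xz xt /= ?xpair_eqE /= => szt -> nadj yadj;
    by [rewrite yadj // szt | rewrite nadj].
Qed.

End NegativePair.

Lemma block_embeds x : [\/ embeds c (block x) f1_slim f1_inc,
  embeds c (block x) f2_slim f2_inc | embeds c (block x) f3_slim f3_inc].
Proof.
have [/block_singleton|xx] := eqVneq (M x x) 0; first by constructor 1.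
have [y xy_lt0] := negM xx; have xy : M x y = -1.
  by have xy0 : M x y != 0; [lia | case: (M_sign xy0); lia].
have [/(block_adjacent xy)|/(block_nonadjacent xy)] := boolP (adj x y).
  by constructor 3.
by constructor 2.
Qed.

End Blocks.

(** * The Hoffman graph *)

Lemma iso_to_induced_inj (k h : hoffman) (g : k -> h) : injective g ->
    (forall x y, adj (g x) (g y) = adj x y) -> (forall x, fat (g x) = fat x) ->
  iso_to_induced k h.
Proof.
move=> g_inj g_adj g_fat; pose U := [set g x | x : k].
have hU : hoffman_set U.
  move=> _ /imsetP[x _ ->]; rewrite g_fat => /fat_has_slim[y sy xy].
  by exists (g y); [apply: imset_f | rewrite g_fat sy g_adj].
have gU x : g x \in U by apply: imset_f.
exists U, hU, (fun x => exist _ (g x) (gU x)); split; last exact: g_fat.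
  apply: inj_card_bij => [x y [] /g_inj //|].
  by rewrite card_sig -(card_imset _ g_inj); apply: eq_leq; apply: eq_card.
by move=> x y; apply: g_adj.
Qed.

Lemma special_entry (h : hoffman) (x y : slim_graph h) :
  special x y = (adj x y)%:R -
    #|[set f in fat_set h | adj (val x) f && adj (val y) f]|%:R.
Proof.
rewrite /special /special_mx !mxE !enum_rankK; congr (_ - _).
rewrite -sum1_card natr_sum.
rewrite (reindex_omap (val : induced_graph (fat_set h) -> h) insub); last first.
  by move=> f; rewrite inE => /andP[ff _]; rewrite insubT.
rewrite (reindex _ (onW_bij _ (enum_val_bij (induced_graph (fat_set h))))) /=.
rewrite [RHS]big_mkcond; apply: eq_bigr => j _; rewrite !mxE !enum_rankK valK eqxx.
rewrite andbT !inE (_ : fat _ = true) /=; last first.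
  by have := valP (enum_val j); rewrite inE.
by do 2 case: adj.
Qed.

(** A generated subgraph keeps all fat neighbors of its slim vertices, so no common fat neighbor is
    lost. *)
Lemma special_generated (h : hoffman) (B : {set slim_graph h})
    (x y : slim_graph (generated B)) :
  special (ind_slim_inj x) (ind_slim_inj y) = special x y.
Proof.
rewrite !special_entry; congr (_ - _%:R).
rewrite -[RHS](card_imset _ val_inj); apply: eq_card => f; rewrite !inE.
apply/idP/imsetP => [/andP[ff /andP[xf yf]]|[g]]; last first.
  by rewrite !inE => gxy ->.
suff fB : f \in generated_set B.
  by exists (exist _ f fB) => //; rewrite !inE; apply/and3P.
rewrite !inE ff /=; apply/orP; right; apply/existsP.
have := valP (val x); rewrite inE => /orP[/imsetP[w wB xw]|]; last first.
  by have := valP x; rewrite !inE => /negbTE sx; rewrite [fat _]sx.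
by exists w; rewrite wB adj_sym -xw.
Qed.

Section FatIncidence.
Variables (G : sgraph) (F : finType) (c : G -> F -> bool).
Hypothesis c_surj : forall f, exists x, c x f.

Definition inc_hoffman : hoffman := sf_hoffman (@adj_sym G) (@adj_irrefl G) c_surj.

Let slimP (x : G) : (inl x : inc_hoffman) \in slim_set inc_hoffman.
Proof. by rewrite inE. Qed.

Definition to_slim (x : G) : slim_graph inc_hoffman := exist _ (inl x) (slimP x).

Lemma to_slim_surj (X : slim_graph inc_hoffman) : exists x, to_slim x == X.
Proof.
case: X => -[x|f] p; first by exists x; apply/eqP/val_inj.
by have := p; rewrite inE.
Qed.

Definition of_slim X : G := xchoose (to_slim_surj X).

Lemma of_slimK : cancel of_slim to_slim.
Proof. by move=> X; apply/eqP/(xchooseP (to_slim_surj X)). Qed.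

Lemma to_slim_inj : injective to_slim.
Proof. by move=> x y [->]. Qed.

Lemma to_slimK : cancel to_slim of_slim.
Proof. by move=> x; apply: to_slim_inj; rewrite of_slimK. Qed.

Lemma special_to_slim x y : x != y ->
  special (to_slim x) (to_slim y) = reduced c x y.
Proof.
move=> /negbTE xy; rewrite special_entry /reduced xy mulr0 addr0.
congr (_ - _%:R); rewrite -(card_imset _ (@inr_inj G F)); apply: eq_card => -[z|f].
  by rewrite !inE; apply/esym/negbTE/imsetP => -[].
by rewrite (mem_imset _ _ (@inr_inj G F)) !inE.
Qed.

Lemma embeds_iso (S K : finType) (e : rel S) (i : S -> K -> bool)
    (e_sym : symmetric e) (e_irrefl : irreflexive e)
    (i_surj : forall f, exists s, i s f) (B : {set slim_graph inc_hoffman}) :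
    embeds c [set x | to_slim x \in B] e i ->
  iso_to_induced (generated B) (sf_hoffman e_sym e_irrefl i_surj).
Proof.
set E := finset _ => -[s [p [s_inj p_inj adjE incE]]].
pose g0 (v : inc_hoffman) : sf_hoffman e_sym e_irrefl i_surj :=
  match v with inl x => inl (s x) | inr f => inr (p f) end.
have slE x : (inl x : inc_hoffman) \in generated_set B -> x \in E.
  rewrite !inE => /orP[/imsetP[X XB xX]|//].
  by suff -> : to_slim x = X by []; apply: val_inj.
have fatE f : (inr f : inc_hoffman) \in generated_set B ->
    f \in \bigcup_(x in E) common c x x.
  rewrite !inE => /orP[/imsetP[X _ fX]|/existsP[X /andP[XB fX]]].
    by have := valP X; rewrite inE -fX.
  apply/bigcupP; exists (of_slim X); rewrite inE ?of_slimK //.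
  by move: fX; rewrite -{1}[X]of_slimK /= => ->.
pose g (v : generated B) := g0 (val v).
apply: (@iso_to_induced_inj (generated B) (sf_hoffman e_sym e_irrefl i_surj) g).
- move=> [[x|f] xB] [[y|f'] yB] //= [].
    by move/(s_inj _ _ (slE _ xB) (slE _ yB)) => E1; apply: val_inj; rewrite /= E1.
  by move/(p_inj _ _ (fatE _ xB) (fatE _ yB)) => E1; apply: val_inj; rewrite /= E1.
- move=> [[x|f] xB] [[y|f'] yB] //=; rewrite /g /ind_adj /=.
  + by rewrite [RHS]adjE ?slE.
  + by rewrite [RHS]incE ?slE ?fatE.
  + by rewrite [RHS]incE ?slE ?fatE.
- by move=> [[x|f] xB].
Qed.

Hypotheses (ge2 : forall x, (2 <= #|common c x x|)%N)
  (blocksM : sign_blocks (reduced c))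
  (negM : forall x, reduced c x x != 0 -> exists y, reduced c x y < 0).

Let rel_slim : rel (slim_graph inc_hoffman) :=
  fun X Y => of_slim Y \in block c (of_slim X).

Let rel_equiv : {in [set: slim_graph inc_hoffman] & &, equivalence_rel rel_slim}.
Proof.
have M_sym := @reduced_sym G F c.
move=> X Y Z _ _ _; rewrite /rel_slim !inE eqxx; split=> // /orP[/eqP -> //|xy].
have yx : reduced c (of_slim Y) (of_slim X) != 0 by rewrite M_sym.
have xx := sign_blocks_diag M_sym blocksM xy.
have yy := sign_blocks_diag M_sym blocksM yx.
rewrite (blocksM (of_slim Z) xy) mulf_eq0 (negbTE xy) /=.
have [<-|xz] := eqVneq (of_slim X) (of_slim Z); first by rewrite yx !orbT.
by case: (eqVneq (of_slim Y) (of_slim Z)) => // <-; rewrite yy.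
Qed.

(** All required fat vertices are already present in [c], so the Hoffman graph is its own extension.
    Its decomposition is the partition into blocks, between which the entries vanish. *)
Lemma inc_hoffman_line : line_hoffman f_family inc_hoffman.
Proof.
exists inc_hoffman; split.
  have hT : hoffman_set [set: inc_hoffman].
    by move=> f _ /fat_has_slim[y sy fy]; exists y; rewrite ?inE // sy.
  exists [set: inc_hoffman], hT; split; last exact: subsetT.
  exists (fun v => exist _ v (in_setT v)); split=> //.
  by exists val => // v; apply: val_inj.
pose P := equivalence_partition rel_slim [set: slim_graph inc_hoffman].
have partP : finset.partition P setT by apply: equivalence_partitionP.
have inP B X Y : B \in P -> X \in B -> Y \in B = rel_slim X Y.
  move=> BP XB; rewrite -(pblock_equivalence_partition rel_equiv) ?inE //.
  by rewrite (def_pblock _ BP XB) //; case/and3P: partP.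
exists P; first split=> //.
- by move=> B _ x y; apply: special_generated.
- move=> B D BP DP BD X Y XB YD.
  have : ~~ rel_slim X Y.
    rewrite -(inP B) //; apply: contra BD => YB; apply/eqP.
    have /and3P[_ triv _] := partP.
    by rewrite -(def_pblock triv BP YB) (def_pblock triv DP YD).
  rewrite /rel_slim inE negb_or negbK => /andP[xy /eqP xy0].
  by rewrite -[X]of_slimK -[Y]of_slimK special_to_slim.
- move=> B BP; have /set0Pn[X XB] : B != finset.set0.
    by case/and3P: partP => _ _; apply: contraNneq => <-.
  have EB : [set x | to_slim x \in B] = block c (of_slim X).
    by apply/setP => y; rewrite inE (inP B X) // /rel_slim to_slimK.
  have [emb|emb|emb] := block_embeds blocksM negM (of_slim X);
    rewrite -EB in emb.
  + by exists ord0; apply: embeds_iso emb.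
  + by exists (Ordinal (isT : 1 < 3)%N); apply: embeds_iso emb.
  + by exists ord_max; apply: embeds_iso emb.
Qed.

Lemma inc_hoffman_2fat : t_fat 2 inc_hoffman.
Proof.
move=> [x|f] // _; apply: leq_trans (ge2 x) _.
rewrite -(card_imset _ (@inr_inj G F)); apply: subset_leq_card.
by apply/subsetP => _ /imsetP[f + ->]; rewrite !inE andbb andbT.
Qed.

Lemma inc_hoffman_slim : graph_iso G (slim_graph inc_hoffman).
Proof. by exists to_slim => //; exists of_slim; [apply: to_slimK|apply: of_slimK]. Qed.

End FatIncidence.

Theorem theorem1p5 (R : realType) :
  exists kappa : nat, (0 < kappa)%N /\
    forall G : sgraph,
      (forall x : G, (kappa < deg x)%N) ->
      (forall x : G, avg_deg R (local_graph x) <= (deg x)%:R - kappa%:R) ->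
      - 3%:R <= lambda_min R G ->
      exists h : hoffman,
        [/\ graph_iso G (slim_graph h), t_fat 2 h & line_hoffman f_family h].
Proof.
have [kappa [kappa_gt0 fatK]] := fat_structure R.
exists kappa; split=> // G degG avgG minG.
have [F [c [surj ge2 blocksM]]] := fatK G degG avgG minG.
have [F' [c' [surj' ge2' blocksM' negM']]] := fat_extension surj ge2 blocksM.
exists (inc_hoffman surj'); split.
- exact: inc_hoffman_slim.
- exact: inc_hoffman_2fat.
- exact: inc_hoffman_line.
Qed.
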